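(* Let $\Lambda$ be a countable character rigid group having at most countably many finite-dimensional unitary representations (up to equivalence). Then every ergodic probability measure preserving action $\Lambda\curvearrowright(X,\mu)$ is either essentially transitive or satisfies $\mu(\mathrm{Fix}(g))=0$ for every $g\in\Lambda\setminus\mathrm{Z}(\Lambda)$.
   Context: For a countable group, a trace is a positive definite, conjugation invariant function $\varphi$ with $\varphi(e)=1$; characters are the extreme points of the convex set of traces; a character is finite-dimensional if it is $\frac{1}{\dim\pi}\mathrm{tr}\circ\pi$ for a finite-dimensional irreducible unitary representation $\pi$. A group is character rigid if every character is either finite-dimensional or vanishes outside its center. $\mathrm{Fix}(g)=\{x\in X:gx=x\}$.
   Formalization: The probability space (X, μ) is assumed to be standard Borel; without this Fix(g) may be non-measurable and the claim fails, e.g. for the trivial action of S_3 on an uncountable set with the countable/co-countable σ-algebra. *)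

(* Defs.v *)
From HB Require Import structures.
From mathcomp Require Import all_boot all_order all_algebra.
From mathcomp Require Import all_classical all_reals all_analysis.
From mathcomp Require Import complex.
Set Implicit Arguments. Unset Strict Implicit. Unset Printing Implicit Defensive.
Import Order.TTheory GRing.Theory Num.Theory.
Local Open Scope classical_set_scope.
Local Open Scope ring_scope.

Section GroupDefs.
Variables (R : realType) (G : groupType).
Local Notation C := R[i].

Definition countable_group : Prop := exists f : G -> nat, injective f.

Definition positive_definite (phi : G -> C) : Prop :=
  forall (n : nat) (g : 'I_n -> G) (c : 'I_n -> C),
    0 <= \sum_(i < n) \sum_(j < n) c i * Num.conj (c j) * phi ((g j)^-1 * g i)%g.

Definition conj_invariant (phi : G -> C) : Prop :=
  forall g h : G, phi (h^-1 * g * h)%g = phi g.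

Definition is_trace (phi : G -> C) : Prop :=
  [/\ positive_definite phi, conj_invariant phi & phi 1%g = 1].

Definition is_character (phi : G -> C) : Prop :=
  is_trace phi /\
  forall (psi1 psi2 : G -> C) (t : R), 0 < t -> t < 1 ->
    is_trace psi1 -> is_trace psi2 ->
    (forall g, phi g = (real_complex R t) * psi1 g + (real_complex R (1 - t)) * psi2 g) ->
    psi1 = psi2.

Definition adjoint m n (A : 'M[C]_(m, n)) : 'M[C]_(n, m) := (map_mx Num.conj A)^T.

Definition unitary_rep n (pi : G -> 'M[C]_n) : Prop :=
  [/\ pi 1%g = 1%:M,
      (forall g h, pi (g * h)%g = pi g *m pi h) &
      (forall g, pi g *m adjoint (pi g) = 1%:M)].

Definition irreducible_rep n (pi : G -> 'M[C]_n) : Prop :=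
  (0 < n)%N /\
  forall U : 'M[C]_n, (forall g, (U *m pi g <= U)%MS) -> U = 0 \/ row_full U.

Definition finite_dim_character (phi : G -> C) : Prop :=
  exists (n : nat) (pi : G -> 'M[C]_n),
    [/\ unitary_rep pi, irreducible_rep pi &
        forall g, phi g = \tr (pi g) / n%:R].

Definition group_center : set G := [set g | forall h, (g * h = h * g)%g].

Definition character_rigid : Prop :=
  forall phi : G -> C, is_character phi ->
    finite_dim_character phi \/ (forall g, ~ group_center g -> phi g = 0).

Definition rep_equiv n m (pi : G -> 'M[C]_n) (rho : G -> 'M[C]_m) : Prop :=
  n = m /\
  exists U : 'M[C]_(n, m),
    [/\ U *m adjoint U = 1%:M, adjoint U *m U = 1%:M &
        forall g, U *m rho g = pi g *m U].

Definition countably_many_fd_reps : Prop :=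
  exists (dim : nat -> nat) (rho : forall k, G -> 'M[C]_(dim k)),
    (forall k, unitary_rep (rho k)) /\
    forall n (pi : G -> 'M[C]_n), unitary_rep pi -> exists k, rep_equiv pi (rho k).

End GroupDefs.

Section ActionDefs.
Variables (R : realType) (d : measure_display) (X : measurableType d).

Definition standard_borel : Prop :=
  exists f : X -> R,
    [/\ injective f, measurable_fun setT f, measurable (range f) &
        forall A : set X, measurable A -> measurable (f @` A)].

Variables (G : groupType) (mu : probability X R) (a : G -> X -> X).

Definition pmp_action : Prop :=
  [/\ (forall x, a 1%g x = x),
      (forall g h x, a (g * h)%g x = a g (a h x)),
      (forall g, measurable_fun setT (a g)) &
      (forall g (A : set X), measurable A -> mu (a g @^-1` A) = mu A)].

Definition ergodic : Prop :=
  forall A : set X, measurable A -> (forall g, a g @^-1` A = A) ->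
    mu A = 0%E \/ mu A = 1%E.

Definition essentially_transitive : Prop :=
  exists x : X, mu (range (fun g => a g x)) = 1%E.

Definition Fix (g : G) : set X := [set x | a g x = x].

End ActionDefs.

(* Main.v *)
(* Let phi g = mu (Fix g); this is a trace.  If phi does not vanish off the center,
   decompose phi into extreme traces.  By rigidity each of them vanishes off the
   center or is one of countably many finite-dimensional characters, so one of the
   latter, chi = tr pi / n, must be an atom: phi - al * chi is positive definite for
   some al > 0.

   The decomposition does not use Choquet's theorem, only finite convex combinations
   E_N of traces, with barycenters tending to phi, which nearly maximize the mean of a
   strictly convex function.  First-order optimality provides affine majorants whose
   E_N-mean is nearly that of the strictly convex function, so most points charged by
   E_N are nearly extreme.  If no chi were an atom, one could choose such points away
   from every chi, and with value bounded away from 0 at a noncentral element; an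
   ultralimit of them would be an extreme trace of neither kind.

   Since phi dominates al * chi, the average of mu {x | g x = h x} over g, h in a finite
   family is at least al / n^2.  Applied to a family almost minimizing this average,
   hence almost translation invariant, this bounds the size of the orbits on a set of
   positive measure, thus almost everywhere by ergodicity.  The minimum over the orbit
   of an injective Borel function X -> R is then almost everywhere equal to a constant
   c, so almost every point lies in the orbit of the unique point of value c. *)
Require Import Defs.
From HB Require Import structures.
From mathcomp Require Import all_boot all_order all_algebra.
From mathcomp Require Import all_classical all_reals all_analysis.
From mathcomp Require Import complex.
From mathcomp Require Import measurable_realfun ring lra.
Set Implicit Arguments. Unset Strict Implicit. Unset Printing Implicit Defensive.
Import Order.TTheory GRing.Theory Num.Theory.
Import numFieldNormedType.Exports.
Local Open Scope classical_set_scope.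
Local Open Scope ring_scope.

(** * Finite convex combinations and extreme points *)

Section FiniteMeans.
Variables (R : realType) (I : Type) (K : set (I -> R)).

(** A finitely supported probability measure on [K], encoded as the functional integrating against
    it: linearity and monotonicity follow by induction on the mixing steps. *)
Inductive fmean : (((I -> R) -> R) -> R) -> Prop :=
| fmean_dirac x : K x -> fmean (fun h => h x)
| fmean_mix E F (t : R) : fmean E -> fmean F -> 0 <= t -> t <= 1 ->
    fmean (fun h => t * E h + (1 - t) * F h).

Definition bary (E : ((I -> R) -> R) -> R) (i : I) : R := E (fun x => x i).

Lemma fmeanD E h k : fmean E -> E (fun x => h x + k x) = E h + E k.
Proof. by elim=> // {}E F t _ -> _ -> _ _; ring. Qed.

Lemma fmeanZ E c h : fmean E -> E (fun x => c * h x) = c * E h.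
Proof. by elim=> // {}E F t _ -> _ -> _ _; ring. Qed.

Lemma fmeanC E c : fmean E -> E (fun=> c) = c.
Proof. by elim=> // {}E F t _ -> _ -> _ _; ring. Qed.

Lemma fmean_le E h k : fmean E -> (forall x, K x -> h x <= k x) -> E h <= E k.
Proof.
move=> + hk; elim=> [x /hk //|{}E F t _ IE _ IF t0 t1].
by apply: lerD; apply: ler_wpM2l; rewrite ?subr_ge0.
Qed.

Lemma fmean_sum E n (h : 'I_n -> (I -> R) -> R) : fmean E ->
  E (fun x => \sum_(k < n) h k x) = \sum_(k < n) E (h k).
Proof.
move=> mE; elim: n h => [|n IH] h.
  by rewrite big_ord0 -[RHS](fmeanC 0 mE); congr E; apply/funext=> x; rewrite big_ord0.
rewrite big_ord_recr /= -IH -fmeanD //; congr E.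
by apply/funext=> x; rewrite big_ord_recr.
Qed.

Lemma fmeanB E h k : fmean E -> E (fun x => h x - k x) = E h - E k.
Proof.
move=> mE; rewrite -[- E k]mulN1r -fmeanZ// -fmeanD//; congr E.
by apply/funext=> x; rewrite mulN1r.
Qed.

Definition convex_closed (U : set (I -> R)) := forall x y (t : R), U x -> U y ->
  0 <= t -> t <= 1 -> U (fun i => t * x i + (1 - t) * y i).

Hypothesis Kconvex : convex_closed K.

(** The normalized combination of [x] and [y]. Membership in [U] is asked only of points of positive
    weight, since a mean may give [U] no mass at all. *)
Lemma convex_merge (U : set (I -> R)) (a b : R) x y : convex_closed U ->
  0 <= a -> 0 <= b -> K x -> K y -> (0 < a -> U x) -> (0 < b -> U y) ->
  exists z, [/\ K z, 0 < a + b -> U z &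
    forall i, (a + b) * z i = a * x i + b * y i].
Proof.
move=> Uc a0 b0 Kx Ky Ux Uy.
have [a00|an0] := eqVneq a 0.
  exists y; split => //; rewrite a00 ?add0r // => i; ring.
have [b00|bn0] := eqVneq b 0.
  exists x; split => //; rewrite b00 ?addr0 // => i; ring.
have {an0}ap : 0 < a by rewrite lt_def an0.
have {bn0}bp : 0 < b by rewrite lt_def bn0.
have abp : 0 < a + b by rewrite addr_gt0.
have t0 : 0 <= a / (a + b) by rewrite divr_ge0 // ltW.
have t1 : a / (a + b) <= 1 by rewrite ler_pdivrMr // mul1r lerDl.
exists (fun i => a / (a + b) * x i + (1 - a / (a + b)) * y i); split.
- exact: Kconvex.
- by move=> _; apply: Uc => //; [exact: Ux|exact: Uy].
- by move=> i; field; rewrite gt_eqF.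
Qed.

Lemma indic_ge0 (U : set (I -> R)) x : 0 <= \1_U x :> R.
Proof. by rewrite indicE ler0n. Qed.

Lemma indic_le1 (U : set (I -> R)) x : \1_U x <= 1 :> R.
Proof. by rewrite indicE lern1 leq_b1. Qed.

Lemma fmean_indic_ge0 E U : fmean E -> 0 <= E \1_U.
Proof. by move=> mE; rewrite -(fmeanC 0 mE); apply: fmean_le => // x _; exact: indic_ge0. Qed.

Lemma fmean_indic_le1 E U : fmean E -> E \1_U <= 1.
Proof. by move=> mE; rewrite -[leRHS](fmeanC 1 mE); apply: fmean_le => // x _; exact: indic_le1. Qed.

(** For positive masses, [u] and [v] are the conditional barycenters on [U] and on its complement;
    the induction merges those of the two halves of a mixture. *)
Lemma fmean_split E U : fmean E -> convex_closed U ->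
  exists u v, [/\ K u, K v, 0 < E \1_U -> U u &
    forall i, bary E i = E \1_U * u i + (1 - E \1_U) * v i].
Proof.
move=> + Uc; elim=> [x Kx|{}E F t mE [u1 [v1 [Ku1 Kv1 Uu1 H1]]] mF
    [u2 [v2 [Ku2 Kv2 Uu2 H2]]] t0 t1].
  exists x, x; split => // [|i]; last by rewrite /bary; ring.
  rewrite indicE; case: (boolP (x \in U)) => [/set_mem//|_]; by rewrite ltxx.
have E0 := fmean_indic_ge0 U mE; have E1 := fmean_indic_le1 U mE.
have F0 := fmean_indic_ge0 U mF; have F1 := fmean_indic_le1 U mF.
have t1' : 0 <= 1 - t by rewrite subr_ge0.
have [||u [Ku Uu Hu]] := @convex_merge U (t * E \1_U) ((1 - t) * F \1_U) u1 u2 Uc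
  (mulr_ge0 t0 E0) (mulr_ge0 t1' F0) Ku1 Ku2.
- by move=> p; apply: Uu1; rewrite lt_def E0 andbT; apply: contraTneq p => ->; rewrite mulr0 ltxx.
- by move=> p; apply: Uu2; rewrite lt_def F0 andbT; apply: contraTneq p => ->; rewrite mulr0 ltxx.
have [||v [Kv _ Hv]] := @convex_merge K (t * (1 - E \1_U)) ((1 - t) * (1 - F \1_U)) v1 v2 Kconvex
  _ _ Kv1 Kv2 (fun=> Kv1) (fun=> Kv2).
- by rewrite mulr_ge0 // subr_ge0.
- by rewrite mulr_ge0 // subr_ge0.
exists u, v; split => // i.
rewrite /bary -/(bary E i) -/(bary F i) H1 H2 Hu.
have -> : 1 - (t * E \1_U + (1 - t) * F \1_U) =
   t * (1 - E \1_U) + (1 - t) * (1 - F \1_U) by ring.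
by rewrite Hv; ring.
Qed.

(** The mass of [U] is lowered to the prescribed weight [eta] by merging the excess weight of [u]
    into [v]. *)
Lemma fmean_split_ge E U (eta : R) : fmean E -> convex_closed U -> 0 < eta -> eta < 1 ->
  eta <= E \1_U ->
  exists u v, [/\ K u, K v, U u & forall i, bary E i = eta * u i + (1 - eta) * v i].
Proof.
move=> mE Uc e0 e1 eE; have [u [v [Ku Kv Uu H]]] := fmean_split mE Uc.
have E1 := fmean_indic_le1 U mE.
have [||w [Kw _ Hw]] := @convex_merge K (E \1_U - eta) (1 - E \1_U) u v Kconvex
  _ _ Ku Kv (fun=> Ku) (fun=> Kv).
- by rewrite subr_ge0.
- by rewrite subr_ge0.
exists u, w; split => //; first by apply: Uu; exact: lt_le_trans eE.
move=> i; rewrite H.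
have -> : 1 - eta = E \1_U - eta + (1 - E \1_U) by ring.
by rewrite Hw; ring.
Qed.

End FiniteMeans.

(** * Penalized maximization of a strictly convex function *)

Section Envelope.
Variables (R : realType) (I : Type) (e : nat -> I) (K : set (I -> R)).
Hypothesis Kbound : forall x i, K x -> `|x i| <= 1.

Definition wt (k : nat) : R := 2^-1 ^+ k.

Lemma wt_gt0 k : 0 < wt k. Proof. by rewrite exprn_gt0 // invr_gt0. Qed.

Lemma wtS k : 2 * wt k.+1 = wt k.
Proof. by rewrite /wt exprS mulrA divff ?mul1r. Qed.

Lemma wt_sum n : \sum_(k < n) wt k = 2 - 2 * wt n.
Proof.
elim: n => [|n IH]; first by rewrite big_ord0 /wt expr0 mulr1 subrr.
by rewrite big_ord_recr /= IH wtS; ring.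
Qed.

Lemma wt_sum_le n : \sum_(k < n) wt k <= 2.
Proof. by rewrite wt_sum gerBl; have := wt_gt0 n; lra. Qed.

Lemma wt_small (d : R) : 0 < d -> exists n0, forall n, (n0 <= n)%N -> wt n <= d.
Proof.
move=> d0.
have : @cvg_to R^o (nbhs (wt @ \oo)) (nbhs (0 : R)).
  by apply: cvg_expr; rewrite ger0_norm ?invr_ge0 // invf_lt1 // ltr1n.
move/cvgrPdist_le => /(_ _ d0) [n0 _ H].
exists n0 => n /H; rewrite sub0r normrN ger0_norm //; exact/ltW/wt_gt0.
Qed.

(** Truncation of a weighted squared l2 norm, which is strictly convex once [e] is surjective.
    Involving finitely many coordinates, it passes to pointwise limits. *)
Definition sqn (n : nat) (x : I -> R) : R := \sum_(k < n) wt k * x (e k) ^+ 2.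

Lemma sqn_ge0 n x : 0 <= sqn n x.
Proof. by apply: sumr_ge0 => k _; rewrite mulr_ge0 ?sqr_ge0 // ltW // wt_gt0. Qed.

Lemma sqr_le1 (a : R) : `|a| <= 1 -> a ^+ 2 <= 1.
Proof. by move=> a1; rewrite -real_normK ?num_real // expr_le1. Qed.

(** As [2 * wt m.+1 = wt m], the sum [sqn m x + 2 * wt m] is nonincreasing in [m] when the
    coordinates are bounded by 1. *)
Lemma sqn_tail n m x : (forall i, `|x i| <= 1) -> (n <= m)%N ->
  sqn m x <= sqn n x + 2 * wt n.
Proof.
move=> x1 nm; suff: sqn m x + 2 * wt m <= sqn n x + 2 * wt n.
  by have := wt_gt0 m; lra.
elim: m nm => [|m IH]; first by rewrite leqn0 => /eqP ->.
rewrite leq_eqVlt => /predU1P[-> //|/IH]; apply: le_trans.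
rewrite /sqn big_ord_recr /= -/(sqn m x) wtS -addrA lerD2l.
have := sqr_le1 (x1 (e m)); have := wt_gt0 m; nra.
Qed.

Lemma sqn_mono n m x : (n <= m)%N -> sqn n x <= sqn m x.
Proof.
elim: m => [|m IH]; first by rewrite leqn0 => /eqP ->.
rewrite leq_eqVlt => /predU1P[-> //|/IH]/le_trans; apply.
rewrite /sqn big_ord_recr /= lerDl mulr_ge0 ?sqr_ge0 // ltW // wt_gt0 //.
Qed.

Variable phi : I -> R.
Hypothesis Kphi : K phi.

(** A small cost forces the barycenter towards [phi], by a penalty of growing strength, and the mean
    of [sqn n] to be large. *)
Definition cost (n : nat) (E : ((I -> R) -> R) -> R) : R :=
  n.+1%:R * sqn n (fun i => bary E i - phi i) - E (sqn n).

Definition value n : R := inf [set cost n E | E in fmean K].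

Lemma sqn_le2 n x : K x -> sqn n x <= 2.
Proof.
move=> Kx; have := @sqn_tail 0 n x (fun i => Kbound i Kx) (leq0n n).
by rewrite /sqn big_ord0 add0r /wt expr0 mulr1.
Qed.

Lemma cost_ge n E : fmean K E -> -2 <= cost n E.
Proof.
move=> mE; rewrite /cost.
have : E (sqn n) <= 2.
  by rewrite -[leRHS](fmeanC 2 mE); apply: fmean_le mE _ => x; exact: sqn_le2.
have := mulr_ge0 (ler0n R n.+1) (sqn_ge0 n (fun i => bary E i - phi i)); lra.
Qed.

Lemma value_has_inf n : has_inf [set cost n E | E in fmean K].
Proof.
split; first by exists (cost n (fun h => h phi)), (fun h => h phi) => //; exact: fmean_dirac.
by exists (-2) => _ [E mE <-]; exact: cost_ge.
Qed.

Lemma value_le n E : fmean K E -> value n <= cost n E.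
Proof. by move=> mE; apply: ge_inf; [exact: (value_has_inf n).2|exists E]. Qed.

Lemma value_le0 n : value n <= 0.
Proof.
apply: (le_trans (value_le n (fmean_dirac Kphi))); rewrite /cost /bary.
rewrite [X in _ * X](_ : _ = 0) ?mulr0 ?sub0r ?oppr_le0 ?sqn_ge0 //.
by rewrite /sqn big1 // => k _; rewrite subrr expr0n mulr0.
Qed.

Lemma value_ge n (c : R) : (forall E, fmean K E -> c <= cost n E) -> c <= value n.
Proof.
move=> H; apply: lb_le_inf => [|_ [E mE <-]]; [exact: (value_has_inf n).1|exact: H].
Qed.

(** From [n] to [n.+1] the penalty does not decrease, and the mean of [sqn] grows by at most
    [wt n]. *)
Lemma valueS n : value n - wt n <= value n.+1.
Proof.
apply: value_ge => E mE; rewrite lerBlDr; apply: (le_trans (value_le n mE)).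
rewrite /cost.
have : E (sqn n.+1) <= E (sqn n) + wt n.
  rewrite -[X in _ + X](fmeanC (wt n) mE) -(fmeanD _ _ mE); apply: fmean_le mE _ => x Kx.
  rewrite /sqn big_ord_recr /= lerD2l.
  have := sqr_le1 (Kbound (e n) Kx); have := wt_gt0 n; nra.
have : sqn n (fun i => bary E i - phi i) <= sqn n.+1 (fun i => bary E i - phi i).
  exact: sqn_mono.
move=> s1 s2; have s0 := sqn_ge0 n (fun i => bary E i - phi i).
rewrite [n.+2%:R]mulrS.
have n0 : 0 <= n.+1%:R :> R by rewrite ler0n.
have := ler_wpM2l n0 s1; nra.
Qed.

(** By [valueS] the sequence [value n - 2 * wt n] is nondecreasing, and it is bounded above by 0. *)
Lemma value_cauchy (d : R) : 0 < d ->
  exists n0, forall n m, (n0 <= n)%N -> (n <= m)%N -> value m - value n <= d.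
Proof.
move=> d0; pose u n := value n - 2 * wt n.
have umono n m : (n <= m)%N -> u n <= u m.
  elim: m => [|m IH]; first by rewrite leqn0 => /eqP ->.
  rewrite leq_eqVlt => /predU1P[-> //|/IH]/le_trans; apply.
  by rewrite /u wtS; have := valueS m; lra.
have hs : has_sup (range u).
  split; first by exists (u 0%N), 0%N.
  exists 0 => _ [n _ <-]; have := value_le0 n; have := wt_gt0 n; rewrite /u; lra.
have [_ [n0 _ <-] H] := sup_adherent d0 hs.
exists n0 => n m n0n nm.
have h1 := umono _ _ n0n.
have h2 : u m <= sup (range u) by apply: sup_upper_bound => //; exists m.
have h3 : wt m <= wt n.
  by apply: ler_wiXn2l => //; rewrite ?invr_ge0 // invf_le1 // ler1n.
move: h1 h2 H; rewrite /u; lra.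
Qed.

(* First-order optimality of E against mixing in a point mass at x. *)
Lemma near_minimizer n (d : R) : 0 < d -> exists E, [/\ fmean K E, cost n E <= value n + d &
  forall x, K x -> sqn n x <= E (sqn n) + 2 * n.+1%:R *
    (\sum_(k < n) wt k * ((bary E (e k) - phi (e k)) * (x (e k) - bary E (e k)))) + d].
Proof.
move=> d0.
pose l : R := n.+1%:R; have l1 : 1 <= l by rewrite ler1n.
(* The mixing weight [s] keeps the second-order term below [s * (d / 2)], as [D <= 8];
   near-optimality within [s * (d / 2)] uses the other half of [d] after division by [s]. *)
pose s := Num.min 1 (d / (16 * l)).
have s0 : 0 < s by rewrite lt_min ltr01 divr_gt0 // mulr_gt0 // (lt_le_trans ltr01).
have s1 : s <= 1 by rewrite ge_min lexx.
have s2 : s * l * 8 <= d / 2.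
  have : s <= d / (16 * l) by rewrite ge_min lexx orbT.
  rewrite ler_pdivlMr ?mulr_gt0 // ?(lt_le_trans ltr01) //; lra.
have sd : 0 < s * (d / 2) by rewrite mulr_gt0 // divr_gt0.
have [_ [E mE <-] HE] := inf_adherent sd (value_has_inf n).
rewrite -/(value n) in HE.
exists E; split => //.
  by apply: (le_trans (ltW HE)); rewrite lerD2l; nra.
move=> x Kx.
have s1' : 0 <= 1 - s by rewrite subr_ge0.
have s1'' : 1 - s <= 1 by rewrite gerBl ltW.
have mF := fmean_mix mE (fmean_dirac Kx) s1' s1''.
have HF := value_le n mF.
set b := bary E.
set B := \sum_(k < n) _.
set D := \sum_(k < n) wt k * (x (e k) - b (e k)) ^+ 2.
have D8 : D <= 8.
  apply: (@le_trans _ _ (\sum_(k < n) 4 * wt k)); last first.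
    by rewrite -mulr_sumr; have := wt_sum_le n; lra.
  apply: ler_sum => k _; rewrite mulrC ler_wpM2r ?(ltW (wt_gt0 _)) //.
  have : `|x (e k)| <= 1 by exact: Kbound.
  have : `|b (e k)| <= 1.
    rewrite ler_norml; apply/andP; split.
      rewrite -(fmeanC (-1) mE); apply: fmean_le mE _ => y Ky.
      by have := Kbound (e k) Ky; rewrite ler_norml => /andP[].
    rewrite -(fmeanC 1 mE); apply: fmean_le mE _ => y Ky.
    by have := Kbound (e k) Ky; rewrite ler_norml => /andP[].
  rewrite !ler_norml => /andP[? ?] /andP[? ?]; nra.
have key : cost n (fun h => (1 - s) * E h + (1 - (1 - s)) * h x) =
    cost n E + s * (2 * l * B - sqn n x + E (sqn n)) + s ^+ 2 * l * D.
  have Hs : sqn n (fun i => bary (fun h => (1 - s) * E h + (1 - (1 - s)) * h x) i - phi i)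
     = sqn n (fun i => b i - phi i) + 2 * s * B + s ^+ 2 * D.
    rewrite /sqn /B /D !mulr_sumr -!big_split /=; apply: eq_bigr => k _.
    by rewrite /bary -/(bary E (e k)) -/b; ring.
  by rewrite /cost -/l -/b Hs; ring.
rewrite key in HF.
have : 0 <= s * (2 * l * B - sqn n x + E (sqn n) + d).
  have : s * l * D <= d / 2.
    apply: le_trans s2; apply: ler_wpM2l => //; nra.
  by move/(ler_wpM2l (ltW s0)); nra.
by rewrite pmulr_rge0 //; lra.
Qed.

End Envelope.

(** * Limits along ultrafilters *)

Section Ultralimits.
Variable R : realType.

(** Compactness of the segment gives a cluster point, and an ultrafilter converges to its cluster
    points. *)
Lemma ultra_limit (F : set_system nat) (FU : UltraFilter F) (u : nat -> R) (b : R) :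
  (forall n, `|u n| <= b) -> exists l : R, u @ F --> l.
Proof.
move=> ub; have FP : ProperFilter F by exact: ultra_proper.
have [|p [_ clp]] := @segment_compact R (- b) b (u @ F).
  by apply: (@filterS _ F _ setT) => [n _|]; [rewrite /= in_itv /= -ler_norml|exact: filterT].
exists p => V Vp.
have [//|FnV] := in_ultra_setVsetC (u @^-1` V) FU.
have [x [/= nVx Vx]] : (~` V `&` V) !=set0 by apply: clp.
by [].
Qed.

Lemma cvg_bigsum (F : set_system nat) (FF : Filter F) n
    (u : nat -> 'I_n -> R) (l : 'I_n -> R) :
  (forall k, (u ^~ k) @ F --> l k) ->
  (fun N => \sum_(k < n) u N k) @ F --> \sum_(k < n) l k.
Proof.
elim: n u l => [|n IH] u l H.
  rewrite big_ord0 (_ : (fun _ => _) = cst 0); first exact: cvg_cst.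
  by apply/funext=> N; rewrite big_ord0.
rewrite big_ord_recr (_ : (fun _ => _) = (fun N => \sum_(k < n) u N (widen_ord (leqnSn n) k)) + u ^~ ord_max) /=.
  by apply: cvgD; [apply: IH => k; exact: H|exact: H].
by apply/funext=> N; rewrite big_ord_recr.
Qed.

Lemma cvg_affine (F : set_system nat) (FF : Filter F) n (c : R) (d : 'I_n -> R)
    (u : nat -> 'I_n -> R) (l : 'I_n -> R) :
  (forall k, (u ^~ k) @ F --> l k) ->
  (fun N => c + \sum_(k < n) d k * u N k) @ F --> c + \sum_(k < n) d k * l k.
Proof.
move=> H; apply: cvgD; first exact: cvg_cst.
by apply: cvg_bigsum => k; apply: cvgM; [exact: cvg_cst|exact: H].
Qed.

End Ultralimits.

(** * Near-optimal means and their affine majorants *)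

Section Choquet.
Variables (R : realType) (I : Type) (e : nat -> I) (K : set (I -> R)).
Hypothesis esurj : forall i, exists n, e n = i.
Hypothesis Kconvex : convex_closed K.
Hypothesis Kbound : forall x i, K x -> `|x i| <= 1.
Hypothesis Klimit : forall (F : set_system nat) (y : nat -> I -> R) l,
  ProperFilter F -> (forall n, K (y n)) -> (forall i, (y ^~ i) @ F --> l i) -> K l.
Variable phi : I -> R.
Hypothesis Kphi : K phi.

Variable E_ : nat -> ((I -> R) -> R) -> R.
Hypothesis mE : forall n, fmean K (E_ n).
Hypothesis costE : forall n, cost e phi n (E_ n) <= value e K phi n + n.+1%:R^-1.
Hypothesis supE : forall n x, K x -> sqn e n x <= E_ n (sqn e n) + 2 * n.+1%:R *
    (\sum_(k < n) wt R k * ((bary (E_ n) (e k) - phi (e k)) * (x (e k) - bary (E_ n) (e k))))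
    + n.+1%:R^-1.

Lemma invS_le1 n : n.+1%:R^-1 <= 1 :> R.
Proof. by rewrite invf_le1 // ?ler1n ?ltr0n. Qed.

(** Comparison with the point mass at [phi] keeps the penalty at most 3, so the squared error in a
    fixed coordinate is of order [1 / N]. *)
Lemma bary_cvg i : (fun N => bary (E_ N) i) @ \oo --> phi i.
Proof.
apply/cvgrPdist_le => d d0; have [k ek] := esurj i.
have w0 := wt_gt0 R k.
have c0 : 0 < wt R k * d ^+ 2 by rewrite mulr_gt0 // exprn_gt0.
near=> N.
have kN : (k < N)%N by near: N; exact: nbhs_infty_gt.
have bigN : 3 / (wt R k * d ^+ 2) <= N%:R by near: N; exact: nbhs_infty_ger.
have sq : N.+1%:R * sqn e N (fun i => bary (E_ N) i - phi i) <= 3.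
  have := costE N; have := value_le0 e Kbound Kphi N; have := invS_le1 N.
  have : E_ N (sqn e N) <= 2.
    by rewrite -[leRHS](fmeanC 2 (mE N)); apply: fmean_le (mE N) _ => x; exact: sqn_le2.
  rewrite /cost; move: (_ * sqn _ _ _) (_^-1) (E_ _ _) (value _ _ _ _) => s t u v h1 h2 h3 h4. lra.
have wk : wt R k * (bary (E_ N) i - phi i) ^+ 2 <= sqn e N (fun i => bary (E_ N) i - phi i).
  rewrite /sqn (bigD1 (Ordinal kN)) //= ek lerDl; apply: sumr_ge0 => j _.
  by rewrite mulr_ge0 ?sqr_ge0 // ltW // wt_gt0.
rewrite distrC -ler_sqr ?nnegrE ?normr_ge0 ?(ltW d0) // real_normK ?num_real //.
rewrite ler_pdivrMr // in bigN.
have N0 : 0 <= N%:R :> R by rewrite ler0n.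
rewrite -(ler_pM2l w0).
rewrite -natr1 in sq.
set a := wt R k * _ in wk *; set b := wt R k * d ^+ 2 in c0 bigN *.
rewrite leNgt; apply/negP => ba.
have h1 := ler_wpM2l N0 wk; have h2 := ler_wpM2l N0 (ltW ba).
lra.
Unshelve. all: by end_near. Qed.

(** First-order optimality at stage [n] bounds [sqn e n] by an affine function [h] of finitely many
    coordinates. Its [E_N]-mean tends to [h phi], which is at most about minus the value at [n],
    while [E_ N (sqn e N)] is at least about minus the value at [N]; [value_cauchy] compares the two
    values. *)
Lemma envelope_stage (d : R) (n0 : nat) : 0 < d -> exists n (c : R) (a : 'I_n -> R),
  [/\ (n0 <= n)%N,
      forall x, K x -> sqn e n x <= c + \sum_(k < n) a k * x (e k) &
      \forall N \near \oo,
        E_ N (fun x => c + \sum_(k < n) a k * x (e k)) - E_ N (sqn e N) <= d].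
Proof.
move=> d0; have d4 : 0 < d / 4 by rewrite divr_gt0.
have [n1 Hn1] := value_cauchy e Kbound Kphi d4.
have [n2 _ Hn2] := nbhs_infty_ger (d / 4)^-1.
pose n := maxn n0 (maxn n1 n2).
have nn1 : (n1 <= n)%N by rewrite !leq_max leqnn !orbT.
have small N : (n <= N)%N -> N.+1%:R^-1 <= d / 4.
  move=> nN; rewrite -[leRHS]invrK lef_pV2 ?posrE ?invr_gt0 ?ltr0n //.
  apply: Hn2 => /=; apply: leqW; apply: leq_trans nN; rewrite /n !leq_max leqnn !orbT //.
pose l : R := n.+1%:R; pose b := bary (E_ n).
pose c := E_ n (sqn e n) + n.+1%:R^-1
  - \sum_(k < n) (2 * l * (wt R k * (b (e k) - phi (e k)))) * b (e k).
pose a (k : 'I_n) := 2 * l * (wt R k * (b (e k) - phi (e k))).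
pose h y := c + \sum_(k < n) a k * y (e k).
have hE y : h y = E_ n (sqn e n) + 2 * n.+1%:R *
    (\sum_(k < n) wt R k * ((b (e k) - phi (e k)) * (y (e k) - b (e k)))) + n.+1%:R^-1.
  have -> : 2 * n.+1%:R * (\sum_(k < n) wt R k * ((b (e k) - phi (e k)) * (y (e k) - b (e k))))
      = \sum_(k < n) a k * y (e k) - \sum_(k < n) a k * b (e k).
    by rewrite mulr_sumr -sumrB; apply: eq_bigr => k _; rewrite /a /l; ring.
  by rewrite /h /c -/a; ring.
exists n, c, a; split; first by rewrite leq_max leqnn.
  by move=> x Kx; rewrite -/(h x) hE; exact: supE.
have Eh N : E_ N h = h (bary (E_ N)).
  rewrite (fmeanD _ _ (mE N)) (fmeanC _ (mE N)) (fmean_sum _ (mE N)); congr (_ + _).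
  by apply: eq_bigr => k _; rewrite (fmeanZ _ _ (mE N)).
(* At [phi] the first-order sum is minus the squared distance from [b] to [phi], so [h phi] is at
   most minus the cost of [E_ n], up to the error term. *)
have hphi : h phi <= - value e K phi n + n.+1%:R^-1.
  have s0 := sqn_ge0 e n (fun i => b i - phi i).
  have -> : h phi = E_ n (sqn e n) - 2 * l * sqn e n (fun i => b i - phi i) + n.+1%:R^-1.
    rewrite hE; congr (_ + _ + _); rewrite -mulrN; congr (_ * _).
    by rewrite /sqn -sumrN; apply: eq_bigr => k _; ring.
  have := value_le e Kbound Kphi n (mE n); rewrite /cost -/l -/b.
  have : 0 <= l * sqn e n (fun i => b i - phi i) by rewrite mulr_ge0 // ler0n.
  rewrite -[2 * l * _]mulrA.
  move: (l * _) (_^-1) (E_ _ _) (value _ _ _ _) => p q r v h1 h2; lra.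
have hcvg : (fun N => h (bary (E_ N))) @ \oo --> h phi.
  by apply: cvg_affine => k; exact: bary_cvg.
have /cvgrPdist_le /(_ _ d4) hcvg' := hcvg.
near=> N.
have nN : (n <= N)%N by near: N; exact: nbhs_infty_ge.
have hN : `|h phi - h (bary (E_ N))| <= d / 4.
  by near: N; exact: hcvg'.
change (E_ N h - E_ N (sqn e N) <= d).
rewrite Eh.
have v := Hn1 _ _ nn1 nN.
have cN := costE N; rewrite /cost in cN.
have s0 := mulr_ge0 (ler0n R N.+1) (sqn_ge0 e N (fun i => bary (E_ N) i - phi i)).
have e1 := small N nN; have e2 := small n (leqnn n).
move: hN; rewrite ler_norml => /andP[hN1 hN2].
move: (_ * sqn _ _ _) (E_ N _) (value _ _ _ N) (value _ _ _ n) N.+1%:R^-1 n.+1%:R^-1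
  (h phi) (h _) s0 v cN hphi hN1 hN2 e1 e2 => s0 q1 q2 q3 q4 q5 q6 q7.
lra.
Unshelve. all: by end_near. Qed.

(** Basic neighbourhoods of [chi] for pointwise convergence, a single parameter governing both the
    number of coordinates and the radius. *)
Definition box (chi : I -> R) (M : nat) : set (I -> R) :=
  [set x | forall i, (i < M)%N -> `|x (e i) - chi (e i)| <= M.+1%:R^-1].

Lemma box_convex chi M : convex_closed (box chi M).
Proof.
move=> x y t Ux Uy t0 t1 i iM.
have -> : t * x (e i) + (1 - t) * y (e i) - chi (e i) =
  t * (x (e i) - chi (e i)) + (1 - t) * (y (e i) - chi (e i)) by ring.
have t1' : 0 <= 1 - t by rewrite subr_ge0.
apply: (le_trans (ler_normD _ _)); rewrite !normrM (ger0_norm t0) (ger0_norm t1').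
have := Ux i iM; have := Uy i iM.
move=> /(ler_wpM2l t1') h2 /(ler_wpM2l t0) h1.
by move: M.+1%:R^-1 h1 h2 => r h1 h2; lra.
Qed.

(* If the means kept mass [d] near [chi], their limit [phi] would dominate [d * chi]. *)
Lemma box_mass_small chi (d : R) : 0 < d -> d < 1 ->
  (forall y, K chi -> K y -> ~ (forall i, phi i = d * chi i + (1 - d) * y i)) ->
  exists M, \forall N \near \oo, E_ N \1_(box chi M) <= d.
Proof.
move=> d0 d1 nodom; apply: contrapT => H.
have H' M : exists N, (M <= N)%N /\ d < E_ N \1_(box chi M).
  apply: contrapT => H2; apply: H; exists M; exists M => // N /= MN.
  by rewrite leNgt; apply/negP => H3; apply: H2; exists N.
pose uv M (N : nat) (p : (I -> R) * (I -> R)) := [/\ (M <= N)%N, K p.1, K p.2, box chi M p.1 &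
   forall i, bary (E_ N) i = d * p.1 i + (1 - d) * p.2 i].
have H2 M : exists Np, uv M Np.1 Np.2.
  have [N [MN dN]] := H' M.
  have [u [v [Ku Kv Uu Huv]]] := fmean_split_ge Kconvex (mE N) (@box_convex chi M) d0 d1 (ltW dN).
  by exists (N, (u, v)); split.
have [f Hf] := choice H2.
(* The first components tend to [chi] because the boxes shrink; the ultralimit of the second
   components is the excluded [y]. *)
have [F [FU Foo]] := ultraFilterLemma (@eventually_filter : ProperFilter \oo).
have FP : ProperFilter F by exact: ultra_proper.
have u_cvg i : (fun M => (f M).2.1 i) @ F --> chi i.
  apply: cvg_trans (_ : (fun M => (f M).2.1 i) @ \oo --> chi i).
    by move=> A /Foo.
  apply/cvgrPdist_le => r r0; have [k ek] := esurj i.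
  near=> M; have [_ _ _ bM _] := Hf M.
  rewrite distrC -ek; apply: (le_trans (bM k _)).
    by near: M; exact: nbhs_infty_gt.
  rewrite -[leRHS]invrK lef_pV2 ?posrE ?invr_gt0 ?ltr0n //.
  apply: (@le_trans _ _ M%:R); last by rewrite ler_nat.
  by near: M; exact: nbhs_infty_ger.
have b_cvg i : (fun M => bary (E_ (f M).1) i) @ F --> phi i.
  apply: cvg_trans (_ : (fun M => bary (E_ (f M).1) i) @ \oo --> phi i).
    by move=> A /Foo.
  apply/cvgrPdist_le => r r0.
  have /cvgrPdist_le/(_ _ r0) [N0 _ HN0] := @bary_cvg i.
  exists N0 => // M /= N0M; apply: HN0 => /=.
  by have [MN _ _ _ _] := Hf M; exact: leq_trans MN.
have H3 i : exists l : R, (fun M => (f M).2.2 i) @ F --> l.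
  apply: (ultra_limit FU (b := 1)) => M.
  by have [_ _ Kv _ _] := Hf M; exact: Kbound.
have [v Hv] := choice H3.
apply: (nodom v).
- by apply: (Klimit FP _ u_cvg) => M; have [] := Hf M.
- by apply: (Klimit FP _ Hv) => M; have [] := Hf M.
move=> i; apply: (cvg_unique _ (@b_cvg i)); first exact: norm_hausdorff.
have -> : (fun M => bary (E_ (f M).1) i) =
   (fun M => d * (f M).2.1 i) + (fun M => (1 - d) * (f M).2.2 i).
  by apply/funext=> M; have [_ _ _ _ ->] := Hf M.
by apply: cvgD; apply: cvgM; [exact: cvg_cst|exact: u_cvg|exact: cvg_cst|exact: Hv].
Unshelve. all: by end_near. Qed.

End Choquet.

(** * An atom among countably many candidates *)

Definition extreme_point (R : realType) (I : Type) (K : set (I -> R)) (x : I -> R) :=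
  K x /\ forall y z (t : R), K y -> K z -> 0 < t -> t < 1 ->
    (forall i, x i = t * y i + (1 - t) * z i) -> y = z.

Lemma filter_forall_lt (F : set_system nat) (FF : Filter F) (P : nat -> nat -> Prop) M :
  (forall i, F (P i)) -> F (fun m => forall i, (i < M)%N -> P i m).
Proof.
move=> FP; elim: M => [|M IH]; first by apply: filterS filterT.
apply: filterS (filterI IH (FP M)) => m [H HM] i.
by rewrite ltnS leq_eqVlt => /predU1P[->|/H].
Qed.

Lemma fmean_indic_markov (R : realType) (I : Type) (K : set (I -> R)) E
    (g : (I -> R) -> R) (c : R) : fmean K E -> 0 < c ->
  (forall x, K x -> 0 <= g x) -> c * E \1_[set x | c < g x] <= E g.
Proof.
move=> mE c0 g0; rewrite -(fmeanZ _ _ mE); apply: fmean_le mE _ => x Kx.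
rewrite indicE; case: (boolP (x \in _)) => [/set_mem /= /ltW|_].
  by rewrite mulr1.
by rewrite mulr0; exact: g0.
Qed.

Lemma fmean_indicU (R : realType) (I : Type) (K : set (I -> R)) E
    (A B : set (I -> R)) : fmean K E -> E \1_(A `|` B) <= E \1_A + E \1_B.
Proof.
move=> mE; rewrite -(fmeanD _ _ mE); apply: fmean_le mE _ => x _.
by rewrite !indicE in_setU; case: (x \in A); case: (x \in B) => //=; rewrite ?addr0 ?add0r // lerDl.
Qed.

(** Otherwise each [chi k] has a neighbourhood of small mass. For large [N] there remain points with
    [eps <= |x j|] that avoid these neighbourhoods and nearly touch the affine majorants; their
    ultralimit is extreme, nonzero at [j] and different from every [chi k]. *)
Theorem extreme_atom (R : realType) (I : Type) (e : nat -> I) (K : set (I -> R))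
    (phi : I -> R) (j : I) (chi : nat -> I -> R) :
  (forall i, exists n, e n = i) -> convex_closed K ->
  (forall x i, K x -> `|x i| <= 1) ->
  (forall (F : set_system nat) (y : nat -> I -> R) (l : I -> R), ProperFilter F ->
     (forall n, K (y n)) -> (forall i, (y ^~ i) @ F --> l i) -> K l) ->
  K phi -> phi j != 0 ->
  (forall x, extreme_point K x -> x j = 0 \/ exists k, x = chi k) ->
  exists k (a : R) y, [/\ 0 < a < 1, K (chi k), K y &
    forall i, phi i = a * chi k i + (1 - a) * y i].
Proof.
move=> esurj Kc Kb Kl Kphi phij ext; apply: contrapT => nodom.
have inv0 n : 0 < n.+1%:R^-1 :> R by rewrite invr_gt0 ltr0n.
have [E_ HE] := choice (fun n => near_minimizer e Kb Kphi n (inv0 n)).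
have mE n : fmean K (E_ n) by have [] := HE n.
have cE n : cost e phi n (E_ n) <= value e K phi n + n.+1%:R^-1 by have [] := HE n.
have sE n := let: And3 _ _ H := HE n in H.
(* Values below [eps], a bad mass of at most [2 * eps] and a barycenter error of [eps / 2] add up to
   less than [4 * eps]. *)
pose eps := `|phi j| / 4.
have eps0 : 0 < eps by rewrite divr_gt0 // normr_gt0.
have eps4 : `|phi j| = 4 * eps by rewrite /eps; field.
have epsle : eps <= 4^-1 by rewrite /eps ler_pdivrMr // mulVf // Kb.
pose w := wt R; have w0 k : 0 < w k := wt_gt0 R k.
have w1 k : w k <= 1 by rewrite /w /wt exprn_ile1 // ?invr_ge0 // invf_le1 // ler1n.
(* Markov's inequality at threshold [w k] turns a mean of at most [2 * d k] into a mass of at most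
   [eps * w k / 2]. *)
pose d k := eps * w k ^+ 2 / 4.
have d0 k : 0 < d k by rewrite divr_gt0 // mulr_gt0 // exprn_gt0.
pose stage k (p : {n : nat & (R * ('I_n -> R))%type}) := let: existT n (c, a) := p in
  [/\ (k <= n)%N, 2 * w n <= d k,
      forall x, K x -> sqn e n x <= c + \sum_(k < n) a k * x (e k) &
      \forall N \near \oo,
        E_ N (fun x => c + \sum_(k < n) a k * x (e k)) - E_ N (sqn e N) <= d k].
have Hst k : exists p, stage k p.
  have [n1 Hn1] := wt_small (divr_gt0 (d0 k) (ltr0n R 2)).
  have [n [c [a [nn h1 h2]]]] :=
    envelope_stage esurj Kb Kphi mE cE sE (maxn k n1) (d0 k).
  exists (existT _ n (c, a)); split => //; first by rewrite (leq_trans _ nn) // leq_maxl.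
  have := Hn1 n; rewrite (leq_trans _ nn) ?leq_maxr // => /(_ isT).
  by rewrite ler_pdivlMr // mulrC.
have [st Hst'] := choice Hst.
pose nk k := projT1 (st k).
pose h k (x : I -> R) := (projT2 (st k)).1 + \sum_(i < nk k) (projT2 (st k)).2 i * x (e i).
have Hk k : [/\ (k <= nk k)%N, 2 * w (nk k) <= d k,
    forall x, K x -> sqn e (nk k) x <= h k x &
      \forall N \near \oo, E_ N (h k) - E_ N (sqn e N) <= d k].
  by have := Hst' k; rewrite /stage /h /nk; case: (st k) => n [c a].
have Hbox k : exists M, \forall N \near \oo, E_ N \1_(box e (chi k) M) <= eps * w k / 2.
  have a0 : 0 < eps * w k / 2 by rewrite divr_gt0 // mulr_gt0.
  have a1 : eps * w k / 2 < 1 by have := w0 k; have := w1 k; nra.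
  apply: (box_mass_small esurj Kc Kb Kl Kphi mE cE a0 a1) => y Kchi Ky Hy.
  by apply: nodom; exists k, (eps * w k / 2), y; split => //; rewrite a0.
have [M HM] := choice Hbox.
(* Points far below the majorant [h k], or close to [chi k]. The summand [2 * w (nk k)] pays for the
   coordinates from [nk k] on, so that the gap is nonnegative on [K] once [nk k <= N]. *)
pose bad k N := [set x | w k < h k x - sqn e N x + 2 * w (nk k)] `|` box e (chi k) (M k).
have Hbad k : \forall N \near \oo, E_ N \1_(bad k N) <= eps * w k.
  have [_ h1 h2 h3] := Hk k.
  near=> N; apply: (le_trans (fmean_indicU _ _ (mE N))).
  have nN : (nk k <= N)%N by near: N; exact: nbhs_infty_ge.
  have b1 : E_ N \1_(box e (chi k) (M k)) <= eps * w k / 2.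
    by near: N; exact: HM.
  have b2 : E_ N (h k) - E_ N (sqn e N) <= d k by near: N; exact: h3.
  have g0 x : K x -> 0 <= h k x - sqn e N x + 2 * w (nk k).
    move=> Kx; have := h2 x Kx; have := sqn_tail e (fun i => Kb x i Kx) nN.
    rewrite -/w; lra.
  have := fmean_indic_markov (mE N) (w0 k) g0.
  rewrite (fmeanD _ _ (mE N)) (fmeanB _ _ (mE N)) (fmeanC _ (mE N)) => b3.
  have b4 : w k * E_ N \1_[set x | w k < h k x - sqn e N x + 2 * w (nk k)] <= w k * (eps * w k / 2).
    apply: (le_trans b3); have -> : w k * (eps * w k / 2) = d k + d k by rewrite /d; field.
    exact: lerD.
  rewrite (ler_pM2l (w0 k)) in b4; have -> : eps * w k = eps * w k / 2 + eps * w k / 2 by field.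
  exact: lerD.
have leaf m : exists Nx : nat * (I -> R), [/\ (m <= Nx.1)%N, K Nx.2, eps <= `|Nx.2 j| &
    forall k, (k < m)%N -> ~ bad k Nx.1 Nx.2].
  have fb : \forall N \near \oo, forall k, (k < m)%N -> E_ N \1_(bad k N) <= eps * w k.
    exact: (@filter_forall_lt _ _ (fun k N => E_ N \1_(bad k N) <= eps * w k)).
  near \oo => N.
  have mN : (m <= N)%N by near: N; exact: nbhs_infty_ge.
  have bN : forall k, (k < m)%N -> E_ N \1_(bad k N) <= eps * w k by near: N; exact: fb.
  have phiN : `|phi j - bary (E_ N) j| <= eps / 2.
    near: N.
    have /cvgrPdist_le := @bary_cvg _ _ e K esurj Kb phi Kphi E_ mE cE j.
    by apply; rewrite divr_gt0.
  (* Without such a point, [|x j|] is below [eps] off the bad sets and at most 1 on them, so its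
     mean is at most [3 * eps]. *)
  apply: contrapT => nleaf.
  have E1 : E_ N (fun x => `|x j|) <= E_ N (fun x => eps + \sum_(k < m) \1_(bad k N) x).
    apply: fmean_le (mE N) _ => x Kx; rewrite leNgt; apply/negP => xj.
    have s0 (P : pred 'I_m) : 0 <= \sum_(k < m | P k) \1_(bad k N) x :> R.
      by apply: sumr_ge0 => k _; exact: indic_ge0.
    apply: nleaf; exists (N, x); split => //=.
      by apply: ltW; apply: le_lt_trans xj; rewrite lerDl (s0 predT).
    move=> k km bkx; move: xj; rewrite (bigD1 (Ordinal km)) //= indicE mem_set //=.
    have := s0 (fun i => i != Ordinal km); have := Kb x j Kx.
    move=> q1 q2 q3; have : 1 < `|x j| by apply: le_lt_trans q3; lra.
    by rewrite ltNge q1.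
  have E2 : E_ N (fun x => eps + \sum_(k < m) \1_(bad k N) x) <= 3 * eps.
    rewrite (fmeanD _ _ (mE N)) (fmeanC _ (mE N)) (fmean_sum _ (mE N)).
    apply: (@le_trans _ _ (eps + \sum_(k < m) eps * w k)).
      by rewrite lerD2l; apply: ler_sum => k _; exact: bN.
    rewrite -mulr_sumr; have := wt_sum_le R m; rewrite -/w; nra.
  have E3 : `|bary (E_ N) j| <= E_ N (fun x => `|x j|).
    rewrite ler_norml -[- _]mulN1r -(fmeanZ _ _ (mE N)); apply/andP; split.
      by apply: fmean_le (mE N) _ => x _; rewrite mulN1r lerNl -normrN ler_norm.
    by apply: fmean_le (mE N) _ => x _; exact: ler_norm.
  have : `|phi j| <= `|phi j - bary (E_ N) j| + `|bary (E_ N) j|.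
    by rewrite -[X in `|X| <= _](subrK (bary (E_ N) j)); exact: ler_normD.
  rewrite eps4; lra.
have [f Hf] := choice leaf.
have [F [FU Foo]] := ultraFilterLemma (@eventually_filter : ProperFilter \oo).
have FP : ProperFilter F by exact: ultra_proper.
have Hpsi i : exists l : R, (fun m => (f m).2 i) @ F --> l.
  by apply: (ultra_limit FU (b := 1)) => m; have [_ ? _ _] := Hf m; exact: Kb.
have [psi psi_cvg] := choice Hpsi.
have Kpsi : K psi by apply: (Kl F _ _ FP _ psi_cvg) => m; have [] := Hf m.
have psij : eps <= `|psi j|.
  have c1 : (fun m => `|(f m).2 j|) @ F --> `|psi j| by apply: cvg_norm; exact: psi_cvg.
  by apply: (cvgr_to_ge c1); apply: nearW => m; have [] := Hf m.
have nchi k : psi <> chi k.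
  move=> psik.
  have Fm : F (fun m => (k < m)%N) by apply: Foo; exists k.+1.
  have FB : F (fun m => forall i, (i < M k)%N -> `|(f m).2 (e i) - chi k (e i)| <= (M k).+1%:R^-1).
    apply: (@filter_forall_lt F _ (fun i m => `|(f m).2 (e i) - chi k (e i)| <= (M k).+1%:R^-1)) => i.
    have /cvgrPdist_le /(_ _ (inv0 (M k))) := psi_cvg (e i).
    by apply: filterS => m; rewrite distrC psik.
  have [m [km Bm]] := filter_ex (filterI Fm FB).
  by have [_ _ _ /(_ k km)] := Hf m; apply; right.
(* The near-equality of [h k] and [sqn] at the chosen points passes to the limit, the tail of [sqn]
   being absorbed by [2 * w (nk k)]. *)
have hpsi k : h k psi <= sqn e (nk k) psi + w k.
  have c1 : (fun m => h k (f m).2) @ F --> h k psi by apply: cvg_affine => i; exact: psi_cvg.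
  have c2 : (fun m => w k + \sum_(i < nk k) w i * ((f m).2 (e i) ^+ 2)) @ F -->
     w k + \sum_(i < nk k) w i * psi (e i) ^+ 2.
    by apply: cvg_affine => i; apply: cvgM; exact: psi_cvg.
  rewrite addrC; apply: (@ler_cvg_to nat F FP R _ _ _ _ c1 c2).
  have Fm : F (fun m => (maxn k.+1 (nk k) <= m)%N) by apply: Foo; exists (maxn k.+1 (nk k)).
  apply: filterS Fm => m; rewrite geq_max => /andP[km nm].
  have [mN Kx _ /(_ k km) nb] := Hf m.
  have : h k (f m).2 - sqn e (f m).1 (f m).2 + 2 * w (nk k) <= w k.
    by rewrite leNgt; apply/negP => lt; apply: nb; left.
  have := sqn_tail e (fun i => Kb _ i Kx) (leq_trans nm mN).
  rewrite -/(sqn e (nk k) (f m).2) -/w; lra.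
suff epsi : extreme_point K psi.
  have [psi0|[k]] := ext _ epsi; last exact: nchi.
  by move: psij; rewrite psi0 normr0 leNgt eps0.
split => // y z t Ky Kz t0 t1 yz; apply/funext => i.
have [k0 ek0] := esurj i.
have tt : 0 < t * (1 - t) by rewrite mulr_gt0 // subr_gt0.
(* At a mixture of [y] and [z], the affine [h k] keeps the average of its values while [sqn] falls
   short of its own by [t * (1 - t) * sqn (y - z)]; [hpsi] bounds this loss. *)
have gap k : t * (1 - t) * sqn e (nk k) (fun i => y i - z i) <= w k.
  have [_ _ hK _] := Hk k.
  have hconv : h k psi = t * h k y + (1 - t) * h k z.
    rewrite /h !mulrDr addrACA !mulr_sumr -big_split /=; congr (_ + _); first by ring.
    by apply: eq_bigr => l _; rewrite yz; ring.
  have sconv : sqn e (nk k) psi = t * sqn e (nk k) y + (1 - t) * sqn e (nk k) z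
      - t * (1 - t) * sqn e (nk k) (fun i => y i - z i).
    rewrite /sqn !mulr_sumr -big_split -sumrB /=; apply: eq_bigr => l _.
    by rewrite yz; ring.
  have := hpsi k; rewrite hconv sconv.
  have := ler_wpM2l (ltW t0) (hK y Ky).
  have t1' : 0 <= 1 - t by rewrite subr_ge0 ltW.
  have := ler_wpM2l t1' (hK z Kz); lra.
apply: contrapT => /eqP; rewrite -subr_eq0 -sqrf_eq0 => yz0.
have sq0 : 0 < (y i - z i) ^+ 2 by rewrite lt_def yz0 sqr_ge0.
pose r := t * (1 - t) * (w k0 * (y i - z i) ^+ 2).
have r0 : 0 < r by rewrite /r mulr_gt0 // mulr_gt0.
have [n1 Hn1] := wt_small (divr_gt0 r0 (ltr0n R 2)).
(* [k0.+1] makes coordinate [k0] count in [sqn e (nk k)], and [n1] makes [w k] at most [r / 2]. *)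
pose k := maxn k0.+1 n1.
have : r <= w k.
  apply: le_trans (gap k); rewrite ler_pM2l //.
  have k0n : (k0 < nk k)%N.
    by have [kn _ _ _] := Hk k; rewrite (leq_trans _ kn) // leq_maxl.
  rewrite /sqn (bigD1 (Ordinal k0n)) //= ek0 lerDl; apply: sumr_ge0 => l _.
  by rewrite mulr_ge0 ?sqr_ge0 // ltW.
have := Hn1 k (leq_maxr _ _); rewrite -/(w k) -/w; lra.
Unshelve. all: by end_near. Qed.

(** * Traces *)

Local Notation cRe := complex.Re.
Local Notation cIm := complex.Im.

Section Traces.
Variables (R : realType) (G : groupType).
Local Notation C := R[i].

Lemma cReD (x y : C) : cRe (x + y) = cRe x + cRe y. Proof. by case: x => a b; case: y. Qed.
Lemma cImD (x y : C) : cIm (x + y) = cIm x + cIm y. Proof. by case: x => a b; case: y. Qed.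
Lemma cReM (x y : C) : cRe (x * y) = cRe x * cRe y - cIm x * cIm y.
Proof. by case: x => a b; case: y. Qed.
Lemma cImM (x y : C) : cIm (x * y) = cRe x * cIm y + cIm x * cRe y.
Proof. by case: x => a b; case: y => c d /=; rewrite [b * c]mulrC. Qed.

Lemma cRe_sum n (F : 'I_n -> C) : cRe (\sum_(i < n) F i) = \sum_(i < n) cRe (F i).
Proof. exact: (big_morph (@cRe R) cReD). Qed.
Lemma cIm_sum n (F : 'I_n -> C) : cIm (\sum_(i < n) F i) = \sum_(i < n) cIm (F i).
Proof. exact: (big_morph (@cIm R) cImD). Qed.

Lemma gec0P (z : C) : reflect (cIm z = 0 /\ 0 <= cRe z) (0 <= z).
Proof. by rewrite lecE /=; apply: (iffP andP) => -[/eqP]. Qed.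

(** Real and imaginary parts become separate real coordinates, to which the results on real-valued
    functions apply. *)
Definition cplx_of (x : G * bool -> R) (g : G) : C := Complex (x (g, true)) (x (g, false)).
Definition real_of (f : G -> C) (p : G * bool) : R := if p.2 then cRe (f p.1) else cIm (f p.1).

Lemma real_ofK f : cplx_of (real_of f) = f.
Proof. by apply/funext=> g; rewrite /cplx_of /real_of /=; case: (f g). Qed.

Lemma cplx_ofK x : real_of (cplx_of x) = x.
Proof. by apply/funext=> -[g []]. Qed.

Definition traces : set (G * bool -> R) := [set x | is_trace (cplx_of x)].

Lemma positive_definite_mix (f1 f2 : G -> C) (s t : R) : 0 <= s -> 0 <= t ->
  positive_definite f1 -> positive_definite f2 ->
  positive_definite (fun g => real_complex R s * f1 g + real_complex R t * f2 g).
Proof.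
move=> s0 t0 p1 p2 n g c.
rewrite (_ : \sum_(i < n) _ =
  real_complex R s * (\sum_(i < n) \sum_(j < n) c i * Num.conj (c j) * f1 ((g j)^-1 * g i)%g)
  + real_complex R t * (\sum_(i < n) \sum_(j < n) c i * Num.conj (c j) * f2 ((g j)^-1 * g i)%g)).
  by rewrite addr_ge0 // mulr_ge0 ?ler0c.
rewrite !mulr_sumr -big_split; apply: eq_bigr => i _.
rewrite !mulr_sumr -big_split; apply: eq_bigr => j _ /=; ring.
Qed.

Lemma cplx_of_mix x y (t : R) g :
  cplx_of (fun i => t * x i + (1 - t) * y i) g =
  real_complex R t * cplx_of x g + real_complex R (1 - t) * cplx_of y g.
Proof. by rewrite /cplx_of; simpc. Qed.

Lemma traces_convex : convex_closed traces.
Proof.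
move=> x y t [px cx x1] [py cy y1] t0 t1; split.
- rewrite (_ : cplx_of _ = (fun g => real_complex R t * cplx_of x g + real_complex R (1 - t) * cplx_of y g)).
    by apply: positive_definite_mix; rewrite ?subr_ge0.
  by apply/funext=> g; rewrite cplx_of_mix.
- by move=> g h; rewrite !cplx_of_mix cx cy.
- by rewrite cplx_of_mix x1 y1 !mulr1 -rmorphD /= addrC subrK.
Qed.

(** Positive definiteness is tested on the elements 1 and [g] with coefficients 1 and [z], for the
    four values 1, -1, i, -i of [z]. Vanishing imaginary parts give hermitian symmetry, and the real
    parts give the four bounds. *)
Lemma trace_bound (f : G -> C) g : is_trace f -> `|cRe (f g)| <= 1 /\ `|cIm (f g)| <= 1.
Proof.
move=> [pf _ f1].
have key (z : C) : z * Num.conj z = 1 -> 0 <= 2 + (z * f g + Num.conj z * f (g^-1)%g).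
  move=> zz; have := pf 2%N (fun i => if i == ord0 then 1%g else g) (fun i => if i == ord0 then 1 else z).
  rewrite !big_ord_recl !big_ord0 /= !addr0 !mulVg !invg1 !mul1g !mulg1 f1.
  rewrite rmorph1 zz !mul1r !mulr1.
  by congr (0 <= _); ring.
have k1 := key 1; have k2 := key (-1); have k3 := key 'i%C; have k4 := key (- 'i%C).
move: k1 k2 k3 k4; rewrite !rmorphN !rmorph1 /= !mulrNN !mulr1.
have -> : Num.conj ('i%C : C) = - 'i%C by apply/eqP; rewrite eq_complex /= ?oppr0 !eqxx.
have -> : 'i%C * - 'i%C = 1 :> C by rewrite mulrN -expr2 sqr_i opprK.
move=> /(_ erefl)/gec0P + /(_ erefl)/gec0P + /(_ erefl)/gec0P + /(_ erefl)/gec0P.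
case: (f g) => a b; case: (f (g^-1)%g) => c d.
rewrite !cImD !cReD !cReM !cImM /=.
move=> [e1 l1] [e2 l2] [e3 l3] [e4 l4].
by rewrite !ler_norml; split; apply/andP; split; lra.
Qed.

Lemma traces_bound x i : traces x -> `|x i| <= 1.
Proof. by case: i => g b /(trace_bound g)[]; case: b. Qed.

(** Each condition is an equation or weak inequality in finitely many coordinates, hence closed
    under pointwise limits. *)
Lemma traces_limit (F : set_system nat) (y : nat -> G * bool -> R) (l : G * bool -> R) :
  ProperFilter F -> (forall n, traces (y n)) -> (forall i, (y ^~ i) @ F --> l i) ->
  traces l.
Proof.
move=> FP Ky yl.
have lim_eq i j : (forall n, y n i = y n j) -> l i = l j.
  move=> yij; apply: (cvg_unique _ (@yl i)); first exact: norm_hausdorff.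
  by rewrite (_ : y ^~ i = y ^~ j); [exact: yl|exact/funext].
split.
- move=> n g c.
  pose S x := \sum_(i < n) \sum_(j < n) c i * Num.conj (c j) * cplx_of x ((g j)^-1 * g i)%g.
  have lim_Re : (fun m => cRe (S (y m))) @ F --> cRe (S l).
    rewrite /S cRe_sum (_ : (fun _ => _) = (fun m => \sum_(i < n) \sum_(j < n)
        cRe (c i * Num.conj (c j) * cplx_of (y m) ((g j)^-1 * g i)%g))); last first.
      by apply/funext=> m; rewrite cRe_sum; apply: eq_bigr => i _; rewrite cRe_sum.
    apply: cvg_bigsum => i; rewrite cRe_sum; apply: cvg_bigsum => j.
    under eq_fun do rewrite cReM.
    by rewrite cReM; apply: cvgB; apply: cvgM; [exact: cvg_cst|exact: yl|exact: cvg_cst|exact: yl].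
  have lim_Im : (fun m => cIm (S (y m))) @ F --> cIm (S l).
    rewrite /S cIm_sum (_ : (fun _ => _) = (fun m => \sum_(i < n) \sum_(j < n)
        cIm (c i * Num.conj (c j) * cplx_of (y m) ((g j)^-1 * g i)%g))); last first.
      by apply/funext=> m; rewrite cIm_sum; apply: eq_bigr => i _; rewrite cIm_sum.
    apply: cvg_bigsum => i; rewrite cIm_sum; apply: cvg_bigsum => j.
    under eq_fun do rewrite cImM.
    by rewrite cImM; apply: cvgD; apply: cvgM; [exact: cvg_cst|exact: yl|exact: cvg_cst|exact: yl].
  have Sy m : cIm (S (y m)) = 0 /\ 0 <= cRe (S (y m)).
    by apply/gec0P; have [+ _ _] := Ky m; apply.
  apply/gec0P; split; last first.
    by apply: (cvgr_to_ge lim_Re); apply: nearW => m; have [] := Sy m.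
  apply: (cvg_unique _ lim_Im); first exact: norm_hausdorff.
  rewrite (_ : (fun _ => _) = cst 0); first exact: cvg_cst.
  by apply/funext=> m; have [] := Sy m.
- move=> g h; rewrite /cplx_of; congr Complex; apply: lim_eq => n.
    by have [_ /(_ g h) + _] := Ky n; rewrite /cplx_of => -[].
  by have [_ /(_ g h) + _] := Ky n; rewrite /cplx_of => -[].
- have y1 m : y m (1%g, true) = 1 /\ y m (1%g, false) = 0.
    by have [_ _] := Ky m; rewrite /cplx_of => -[-> ->].
  have l1 : l (1%g, true) = 1.
    apply: (cvg_unique _ (@yl _)); first exact: norm_hausdorff.
    rewrite (_ : (fun _ => _) = cst 1); first exact: cvg_cst.
    by apply/funext=> m; have [-> _] := y1 m.
  have l0 : l (1%g, false) = 0.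
    apply: (cvg_unique _ (@yl _)); first exact: norm_hausdorff.
    rewrite (_ : (fun _ => _) = cst 0); first exact: cvg_cst.
    by apply/funext=> m; have [_ ->] := y1 m.
  by rewrite /cplx_of l1 l0.
Qed.

Lemma extreme_trace_character x : extreme_point traces x -> is_character (cplx_of x).
Proof.
move=> [Kx ext]; split => // f1 f2 t t0 t1 T1 T2 H.
rewrite -(real_ofK f1) -(real_ofK f2); congr cplx_of.
apply: (ext _ _ t) => //; rewrite /traces /= ?real_ofK //.
move=> [g b]; have Hg := H g.
have Hr := congr1 (@cRe R) Hg; have Hi := congr1 (@cIm R) Hg.
move: Hr Hi; rewrite cReD cImD !cReM !cImM /= !mul0r !subr0 !addr0 => Hr Hi.
by case: b.
Qed.

End Traces.

(** * Lower bounds from a dominated finite-dimensional character *)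

Section Domination.
Variables (R : realType) (G : groupType).
Local Notation C := R[i].

Lemma unitary_inv n (pi : G -> 'M[C]_n) g : unitary_rep pi -> pi (g^-1)%g = adjoint (pi g).
Proof.
move=> [p1 pM pU].
by rewrite -[LHS]mulmx1 -(pU g) mulmxA -pM mulVg p1 mul1mx.
Qed.

Lemma unitary_trace n (pi : G -> 'M[C]_n) g h : unitary_rep pi ->
  \sum_(p : 'I_n * 'I_n) pi g p.1 p.2 * Num.conj (pi h p.1 p.2) = \tr (pi (h^-1 * g)%g).
Proof.
move=> pU; have [_ pM _] := pU.
rewrite pM unitary_inv // mxtrace_mulC /mxtrace -(pair_bigA _ (fun i j => pi g i j * Num.conj (pi h i j))) /=.
apply: eq_bigr => i _; rewrite mxE; apply: eq_bigr => j _.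
by rewrite /adjoint !mxE.
Qed.

(** By [unitary_trace] the sum is that of the squares of the moduli of
    [\sum_i Num.conj (u i p) * u i q] over all [p], [q]. The terms [p = q] contribute the squares of
    the [s p]; these [n ^ 2] numbers have sum [N * n], and Cauchy-Schwarz gives [N ^ 2]. *)
Lemma character_gram_lower_bound n (pi : G -> 'M[C]_n) N (g : 'I_N -> G) : unitary_rep pi ->
  (0 < n)%N ->
  N%:R ^+ 2 <= \sum_(p : 'I_n * 'I_n) \sum_(i < N) \sum_(j < N)
     (Num.conj (pi (g i) p.1 p.2) * pi (g j) p.1 p.2 * \tr (pi ((g j)^-1 * g i)%g)).
Proof.
move=> pU n0; pose u i (p : 'I_n * 'I_n) := pi (g i) p.1 p.2.
pose s p := \sum_(i < N) u i p * Num.conj (u i p).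
have n0' : (n%:R : C) != 0 by rewrite pnatr_eq0 -lt0n.
have trN i : \sum_p u i p * Num.conj (u i p) = n%:R.
  by rewrite (unitary_trace (g i) (g i) pU) mulVg; have [-> _ _] := pU; rewrite mxtrace1.
have sums : \sum_p s p = N%:R * n%:R.
  rewrite exchange_big /=; under eq_bigr do rewrite trN.
  by rewrite sumr_const card_ord mulr_natl.
have sreal p : s p \is Num.real.
  by apply: ger0_real; apply: sumr_ge0 => i _; exact: mul_conjC_ge0.
apply: (@le_trans _ _ (\sum_p s p ^+ 2)).
  have : 0 <= \sum_p (s p - N%:R / n%:R) ^+ 2.
    apply: sumr_ge0 => p _; rewrite real_exprn_even_ge0 // rpredB // rpred_div //; exact: realn.
  have -> : \sum_p (s p - N%:R / n%:R) ^+ 2 = \sum_p s p ^+ 2 - N%:R ^+ 2.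
    pose m : C := N%:R / n%:R.
    transitivity (\sum_(p : 'I_n * 'I_n) (s p ^+ 2 + (- (2 * m) * s p + m ^+ 2))).
      by apply: eq_bigr => p _; rewrite -/m; ring.
    rewrite !big_split /= -mulr_sumr sums sumr_const card_prod card_ord -[m ^+ 2 *+ _]mulr_natl natrM.
    by rewrite /m; field.
  by rewrite subr_ge0.
have -> : \sum_(p : 'I_n * 'I_n) \sum_(i < N) \sum_(j < N)
     (Num.conj (u i p) * u j p * \tr (pi ((g j)^-1 * g i)%g)) =
  \sum_p \sum_q `|\sum_(i < N) Num.conj (u i p) * u i q| ^+ 2.
  apply: eq_bigr => p _.
  under [RHS]eq_bigr => q _.
    rewrite normCK rmorph_sum mulr_suml.
    under eq_bigr do rewrite mulr_sumr.
    over.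
  rewrite [RHS]exchange_big /=; apply: eq_bigr => i _.
  rewrite [RHS]exchange_big /=; apply: eq_bigr => j _.
  rewrite -unitary_trace // mulr_sumr; apply: eq_bigr => q _.
  by rewrite rmorphM /= conjCK /u; ring.
apply: ler_sum => p _; rewrite (bigD1 p) //= -[leLHS]addr0 lerD //; last first.
  by apply: sumr_ge0 => q _; rewrite exprn_ge0.
have -> : \sum_(i < N) Num.conj (u i p) * u i p = s p.
  by apply: eq_bigr => i _; rewrite mulrC.
by rewrite real_normK.
Qed.

(* Testing positive definiteness of [phi - a * chi] on each matrix coefficient of
   [pi] and summing over the coefficients produces the factor [tr pi], which makes
   the right-hand side a sum of squares. *)
Lemma dominated_lower_bound n (pi : G -> 'M[C]_n) (a : R) (chi y : G -> C) (r : G -> R)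
    N (g : 'I_N -> G) :
  unitary_rep pi -> (0 < n)%N -> (forall h, chi h = \tr (pi h) / n%:R) -> is_trace chi ->
  positive_definite y -> 0 <= a -> a <= 1 -> (forall h, 0 <= r h) ->
  (forall h, real_complex R (r h) = real_complex R a * chi h + real_complex R (1 - a) * y h) ->
  a / n%:R ^+ 2 * N%:R ^+ 2 <= \sum_(i < N) \sum_(j < N) r ((g j)^-1 * g i)%g.
Proof.
move=> pU n0 chiE tchi py a0 a1 r0 rE.
pose u i (p : 'I_n * 'I_n) := pi (g i) p.1 p.2.
pose x i j := ((g j)^-1 * g i)%g.
have n0' : (n%:R : C) != 0 by rewrite pnatr_eq0 -lt0n.
have n0R : 0 < n%:R :> R by rewrite ltr0n.
have trE h : \tr (pi h) = n%:R * chi h by rewrite chiE mulrC divfK.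
pose W (z : G -> C) := \sum_(p : 'I_n * 'I_n) \sum_(i < N) \sum_(j < N)
    Num.conj (u i p) * u j p * z (x i j).
have Wy : 0 <= W y.
  apply: sumr_ge0 => p _; have := py N g (fun i => Num.conj (u i p)).
  by congr (0 <= _); apply: eq_bigr => i _; apply: eq_bigr => j _; rewrite conjCK.
have Wtr := character_gram_lower_bound g pU n0.
rewrite -/(W (fun h => \tr (pi h))) in Wtr.
have Wr : W (fun h => real_complex R (r h)) =
    real_complex R a / n%:R * W (fun h => \tr (pi h)) + real_complex R (1 - a) * W y.
  rewrite /W !mulr_sumr -big_split; apply: eq_bigr => p _ /=.
  rewrite !mulr_sumr -big_split; apply: eq_bigr => i _ /=.
  rewrite !mulr_sumr -big_split; apply: eq_bigr => j _ /=.
  by rewrite rE chiE; ring.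
have lowC : real_complex R a / n%:R * N%:R ^+ 2 <= W (fun h => real_complex R (r h)).
  rewrite Wr -[leLHS]addr0; apply: lerD; last by rewrite mulr_ge0 // ler0c subr_ge0.
  by apply: ler_wpM2l => //; rewrite mulr_ge0 ?invr_ge0 ?ler0n // ler0c.
(* Summed over the entries [p], the coefficients give the conjugate of [\tr (pi (x i j))], which is
   [n] times that of [chi]. As the real part of [chi] is at most 1, only [n] times the sum of [r] is
   left. *)
have WrE : W (fun h => real_complex R (r h)) = \sum_(i < N) \sum_(j < N)
    n%:R * Num.conj (chi (x i j)) * real_complex R (r (x i j)).
  rewrite /W exchange_big /=; apply: eq_bigr => i _.
  rewrite exchange_big /=; apply: eq_bigr => j _.
  rewrite -mulr_suml; congr (_ * _).
  rewrite -[n%:R]conjC_nat -rmorphM -trE -(unitary_trace (g i) (g j) pU) rmorph_sum.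
  by apply: eq_bigr => p _; rewrite rmorphM /= conjCK.
have ReW : cRe (W (fun h => real_complex R (r h))) =
    n%:R * \sum_(i < N) \sum_(j < N) cRe (chi (x i j)) * r (x i j).
  rewrite WrE cRe_sum mulr_sumr; apply: eq_bigr => i _.
  rewrite cRe_sum mulr_sumr; apply: eq_bigr => j _.
  rewrite -(rmorph_nat (real_complex R) n) cReM cReM cImM /=.
  by case: (chi _) => c d /=; ring.
have low : a / n%:R * N%:R ^+ 2 <= n%:R * \sum_(i < N) \sum_(j < N) r (x i j).
  apply: (@le_trans _ _ (cRe (W (fun h => real_complex R (r h))))).
    move: lowC; rewrite -(rmorph_nat (real_complex R) n) -(rmorph_nat (real_complex R) N).
    by rewrite -rmorphXn -fmorphV -!rmorphM /= lecE => /andP[].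
  rewrite ReW ler_pM2l //; apply: ler_sum => i _; apply: ler_sum => j _.
  rewrite -[leRHS]mul1r ler_wpM2r //; have [+ _] := trace_bound (x i j) tchi.
  exact: le_trans (ler_norm _).
have -> : a / n%:R ^+ 2 * N%:R ^+ 2 = a / n%:R * N%:R ^+ 2 / n%:R by field; rewrite gt_eqF.
by rewrite ler_pdivrMr // [leRHS]mulrC.
Qed.

End Domination.

(** * Coincidence sets and orbits of an action *)

Section Mean.
Variables (R : realType) (d : measure_display) (X : measurableType d) (mu : probability X R).

Definition has_mean (F : X -> R) (r : R) :=
  mu.-integrable setT (EFin \o F) /\ (\int[mu]_x (F x)%:E = r%:E)%E.

Lemma has_mean_indic A : measurable A -> has_mean \1_A (fine (mu A)).
Proof.
move=> mA; split; first exact: integrable_indic.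
by rewrite integral_indic // setIT fineK // fin_num_measure.
Qed.

Lemma has_meanD F H r s : has_mean F r -> has_mean H s ->
  has_mean (fun x => F x + H x) (r + s).
Proof.
move=> [iF eF] [iH eH]; split.
  rewrite (_ : EFin \o _ = (EFin \o F) \+ (EFin \o H))%E; first exact: integrableD.
  exact/funext.
by under eq_integral do rewrite EFinD; rewrite integralD // eF eH.
Qed.

Lemma has_meanZ F r (c : R) : has_mean F r -> has_mean (fun x => c * F x) (c * r).
Proof.
move=> [iF eF]; split.
  rewrite (_ : EFin \o _ = (fun x => c%:E * (EFin \o F) x)%E); first exact: integrableZl.
  exact/funext.
by under eq_integral do rewrite EFinM; rewrite integralZl // eF.
Qed.

Lemma has_mean_cst (c : R) : has_mean (fun=> c) c.
Proof.
have := has_meanZ c (has_mean_indic measurableT).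
rewrite probability_setT /= mulr1; congr has_mean.
by apply/funext=> x; rewrite indicE in_setT mulr1.
Qed.

Lemma has_mean_sum (I : Type) (s : seq I) (F : I -> X -> R) (r : I -> R) :
  (forall i, has_mean (F i) (r i)) ->
  has_mean (fun x => \sum_(i <- s) F i x) (\sum_(i <- s) r i).
Proof.
move=> H; elim: s => [|i s IH].
  rewrite big_nil (_ : (fun _ => _) = fun=> 0); first exact: has_mean_cst.
  by apply/funext=> x; rewrite big_nil.
rewrite big_cons (_ : (fun _ => _) = (fun x => F i x + \sum_(j <- s) F j x)).
  exact: has_meanD.
by apply/funext=> x; rewrite big_cons.
Qed.

Lemma has_mean_le F H r s : has_mean F r -> has_mean H s ->
  (forall x, F x <= H x) -> r <= s.
Proof.
move=> [iF eF] [iH eH] FH; rewrite -lee_fin -eF -eH; apply: le_integral => //.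
by move=> x _; rewrite lee_fin.
Qed.

End Mean.

(** * Counting coincidences in finite sequences *)

Lemma eq_sum_indic (S : pzSemiRingType) (T : eqType) (Y : seq T) (u v : T) :
  uniq Y -> u \in Y ->
  (u == v)%:R = \sum_(y <- Y) (u == y)%:R * (v == y)%:R :> S.
Proof.
move=> uY uinY; rewrite (bigD1_seq u) //= eqxx mul1r big1 ?addr0 1?eq_sym // => y yu.
by rewrite eq_sym (negbTE yu) mul0r.
Qed.

Section Counting.
Variables (R : realType) (T : eqType).

Lemma count_sum (A : seq T) y : (count_mem y A)%:R = \sum_(u <- A) (u == y)%:R :> R.
Proof. by rewrite -sum1_count natr_sum big_mkcond; apply: eq_bigr => u _ /=; case: eqP. Qed.

Lemma pairing_count (Y A B : seq T) : uniq Y -> {subset A <= Y} ->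
  \sum_(u <- A) \sum_(v <- B) (u == v)%:R =
  \sum_(y <- Y) (count_mem y A)%:R * (count_mem y B)%:R :> R.
Proof.
move=> uY AY; under [RHS]eq_bigr do rewrite !count_sum mulr_suml.
rewrite [RHS]exchange_big /=; rewrite big_seq [RHS]big_seq; apply: eq_bigr => u uA.
under [RHS]eq_bigr do rewrite mulr_sumr.
rewrite [RHS]exchange_big /=; apply: eq_bigr => v _.
by apply: eq_sum_indic => //; exact: AY.
Qed.

(** By [pairing_count] the right-hand side is the squared l2 distance between the multiplicity
    functions of [A] and [B], and the left-hand side is one of its terms. *)
Lemma count_diff_sqr (A B : seq T) (y : T) :
  ((count_mem y A)%:R - (count_mem y B)%:R) ^+ 2 <=
  \sum_(u <- A) \sum_(v <- A) (u == v)%:R + \sum_(u <- B) \sum_(v <- B) (u == v)%:R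
  - 2 * \sum_(u <- A) \sum_(v <- B) (u == v)%:R :> R.
Proof.
pose Y := undup (y :: A ++ B); have uY : uniq Y by exact: undup_uniq.
have AY : {subset A <= Y} by move=> u uA; rewrite mem_undup inE mem_cat uA orbT.
have BY : {subset B <= Y} by move=> u uB; rewrite mem_undup inE mem_cat uB !orbT.
have yY : y \in Y by rewrite mem_undup mem_head.
rewrite !(@pairing_count Y) // mulr_sumr -big_split -sumrB /=.
rewrite (bigD1_seq y) //= -[leLHS]addr0 lerD //; first by rewrite sqrrB -!expr2; lra.
apply: sumr_ge0 => z _.
by have := sqr_ge0 ((count_mem z A)%:R - (count_mem z B)%:R : R); rewrite sqrrB; lra.
Qed.

Lemma sum_count_uniq (A Y : seq T) : uniq Y -> (\sum_(y <- Y) count_mem y A <= size A)%N.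
Proof.
move=> uY; elim: A => [|u A IH]; first by rewrite big1.
rewrite /= big_split /= -add1n leq_add //.
have [uinY|unY] := boolP (u \in Y).
  by rewrite (bigD1_seq u) //= eqxx big1 // => y yu; rewrite eq_sym (negbTE yu).
by rewrite big_seq big1 // => y yY; case: eqP unY yY => // ->; move/negbTE => ->.
Qed.

End Counting.

(** * Measures of fixed point sets as a trace *)

Section Action.
Variables (R : realType) (d : measure_display) (X : measurableType d) (mu : probability X R).
Variables (G : groupType) (a : G -> X -> X) (f : X -> R).
Hypothesis finj : injective f.
Hypothesis fmeas : measurable_fun setT f.
Hypothesis pmp : pmp_action mu a.

Let a1 x : a 1%g x = x. Proof. by have [] := pmp. Qed.
Let aM g h x : a (g * h)%g x = a g (a h x). Proof. by have [] := pmp. Qed.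
Let ameas g : measurable_fun setT (a g). Proof. by have [] := pmp. Qed.
Let amu g A : measurable A -> mu (a g @^-1` A) = mu A. Proof. by have [_ _ _ ] := pmp; apply. Qed.

Lemma act_inj g : injective (a g).
Proof. by move=> x y /(congr1 (a g^-1%g)); rewrite -!aM mulVg !a1. Qed.

(** Reading the orbit map through an injection into the reals makes equality of orbit points
    measurable and gives each orbit a linear order. *)
Definition label (x : X) (g : G) : R := f (a g x).

Lemma label_measurable g : measurable_fun setT (label^~ g).
Proof. exact: measurableT_comp. Qed.

Lemma labelM x k g h : (label x (k * g)%g == label x (k * h)%g) = (label x g == label x h).
Proof.
rewrite /label !aM; apply/eqP/eqP => [/finj/act_inj -> //|/finj -> //].
Qed.

Definition coincide (g h : G) : set X := [set x | label x g == label x h].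

Lemma measurable_coincide g h : measurable (coincide g h).
Proof.
rewrite (_ : coincide g h = (fun x => label x g == label x h) @^-1` [set true]).
  rewrite -[_ @^-1` _]setTI.
  by apply: (measurable_fun_eqr (label_measurable g) (label_measurable h)).
by apply/seteqP; split => x.
Qed.

Definition coincidence (g h : G) : R := fine (mu (coincide g h)).

Lemma indic_coincide g h x : \1_(coincide g h) x = (label x g == label x h)%:R :> R.
Proof.
rewrite indicE (_ : (x \in coincide g h) = (label x g == label x h)) //.
by apply/idP/idP => [/set_mem //|xgh]; exact/mem_set.
Qed.

Lemma coincide_mean g h :
  has_mean mu (fun x => (label x g == label x h)%:R) (coincidence g h).
Proof.
have := has_mean_indic mu (measurable_coincide g h); congr has_mean.
by apply/funext=> x; rewrite indic_coincide.
Qed.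

Lemma coincideE g h : coincide g h = Fix a (h^-1 * g)%g.
Proof.
apply/seteqP; split => x /=; rewrite /coincide /Fix /= -(labelM _ h^-1%g) mulVg /label a1.
  by move=> /eqP/finj.
by move=> ->.
Qed.

Lemma coincidence_ge0 g h : 0 <= coincidence g h.
Proof. by rewrite /coincidence fine_ge0. Qed.

Lemma coincidenceM k g h : coincidence (k * g)%g (k * h)%g = coincidence g h.
Proof.
by rewrite /coincidence; congr (fine (mu _)); apply/seteqP; split => x; rewrite /coincide /= labelM.
Qed.

Lemma coincidenceC g h : coincidence g h = coincidence h g.
Proof.
by rewrite /coincidence; congr (fine (mu _)); apply/seteqP; split => x; rewrite /coincide /= eq_sym.
Qed.

Definition fix_measure (g : G) : R := fine (mu (Fix a g)).

Lemma coincidence_fix g h : coincidence g h = fix_measure (h^-1 * g)%g.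
Proof. by rewrite /coincidence coincideE. Qed.

Lemma measurable_Fix g : measurable (Fix a g).
Proof. by have := measurable_coincide g 1%g; rewrite coincideE invg1 mul1g. Qed.

Local Notation C := R[i].

(** For fixed [x], the matrix of coincidences is the Gram matrix of point masses on the orbit, hence
    positive; integration preserves this. Conjugation invariance holds since conjugating by [h]
    replaces the fixed set by its preimage under [a h]. *)
Lemma fix_measure_trace : is_trace (fun g => real_complex R (fix_measure g)).
Proof.
split.
- move=> n g c.
  pose z i j := c i * Num.conj (c j).
  pose e x i j : R := (label x (g i) == label x (g j))%:R.
  have pos x : 0 <= \sum_(i < n) \sum_(j < n) z i j * real_complex R (e x i j).
    pose Y := undup [seq label x (g i) | i <- enum 'I_n].
    have uY : uniq Y by exact: undup_uniq.
    have inY i : label x (g i) \in Y by rewrite mem_undup; apply/mapP; exists i; rewrite ?mem_enum.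
    rewrite (_ : \sum_(i < n) _ = \sum_(y <- Y) `|\sum_(i < n) c i * (label x (g i) == y)%:R| ^+ 2).
      by apply: sumr_ge0 => y _; rewrite exprn_ge0.
    under [RHS]eq_bigr => y _.
      rewrite normCK rmorph_sum mulr_suml.
      under eq_bigr do rewrite mulr_sumr.
      over.
    rewrite [RHS]exchange_big /=; apply: eq_bigr => i _.
    rewrite [RHS]exchange_big /=; apply: eq_bigr => j _.
    rewrite /e (rmorph_nat (real_complex R)) (eq_sum_indic C _ uY (inY i)) mulr_sumr.
    by apply: eq_bigr => y _; rewrite rmorphM /= conjC_nat /z; ring.
  (* [t] stands for the real or the imaginary part, which are integrated separately. *)
  have mean (t : C -> R) : (forall w (s : R), t (w * real_complex R s) = t w * s) ->
      has_mean mu (fun x => \sum_(i < n) \sum_(j < n) t (z i j * real_complex R (e x i j)))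
      (\sum_(i < n) \sum_(j < n) t (z i j * real_complex R (fix_measure ((g j)^-1 * g i)%g))).
    move=> tM; apply: has_mean_sum => i; apply: has_mean_sum => j.
    rewrite tM (_ : (fun _ => _) = (fun x => t (z i j) * e x i j)).
      by rewrite -coincidence_fix; apply: has_meanZ; exact: coincide_mean.
    by apply/funext => x; rewrite tM.
  have tRe w (s : R) : cRe (w * real_complex R s) = cRe w * s.
    by rewrite cReM /= mulr0 subr0.
  have tIm w (s : R) : cIm (w * real_complex R s) = cIm w * s.
    by rewrite cImM /= mulr0 add0r.
  have mRe := mean _ tRe; have mIm := mean _ tIm.
  apply/gec0P; rewrite cRe_sum cIm_sum.
  under [X in X = 0]eq_bigr do rewrite cIm_sum.
  under [X in 0 <= X]eq_bigr do rewrite cRe_sum.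
  have posP x : \sum_(i < n) \sum_(j < n) cIm (z i j * real_complex R (e x i j)) = 0 /\
      0 <= \sum_(i < n) \sum_(j < n) cRe (z i j * real_complex R (e x i j)).
    have /gec0P[p1 p2] := pos x; split.
      by rewrite -[RHS]p1 cIm_sum; apply: eq_bigr => i _; rewrite cIm_sum.
    by move: p2; rewrite cRe_sum; congr (0 <= _); apply: eq_bigr => i _; rewrite cRe_sum.
  split; last first.
    by apply: (has_mean_le (has_mean_cst mu 0) mRe) => x; have [] := posP x.
  apply/eqP; rewrite eq_le; apply/andP; split.
    by apply: (has_mean_le mIm (has_mean_cst mu 0)) => x; have [->] := posP x.
  by apply: (has_mean_le (has_mean_cst mu 0) mIm) => x; have [->] := posP x.
- move=> g h; congr (real_complex R (fine _)).
  rewrite -[RHS](amu h (measurable_Fix g)); congr (mu _).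
  apply/seteqP; split => x; rewrite /Fix /= !aM.
    by move=> E; rewrite -[in RHS]E -[RHS]aM mulgV a1.
  by move=> ->; rewrite -aM mulVg a1.
- rewrite /fix_measure (_ : Fix a 1%g = setT) ?probability_setT //.
  by apply/seteqP; split => x // _; rewrite /Fix /= a1.
Qed.

Lemma gram_coincidence (c : R) :
  (forall N (g : 'I_N -> G), c * N%:R ^+ 2 <=
     \sum_(i < N) \sum_(j < N) fix_measure ((g j)^-1 * g i)%g) ->
  forall s : seq G, c * (size s)%:R ^+ 2 <= \sum_(g <- s) \sum_(h <- s) coincidence g h.
Proof.
move=> H s; apply: le_trans (H (size s) (fun i => nth 1%g s i)) _.
rewrite (big_nth 1%g) big_mkord; apply: ler_sum => i _.
by rewrite (big_nth 1%g) big_mkord; apply: ler_sum => j _; rewrite coincidence_fix.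
Qed.

(** * Translates of finite families and visit counts *)

Definition gram (s t : seq G) : R := \sum_(g <- s) \sum_(h <- t) coincidence g h.
Definition gram_at (x : X) (s t : seq G) : R :=
  \sum_(g <- s) \sum_(h <- t) (label x g == label x h)%:R.

Lemma gram_mean s t : has_mean mu (fun x => gram_at x s t) (gram s t).
Proof. by apply: has_mean_sum => g; apply: has_mean_sum => h; exact: coincide_mean. Qed.

Lemma gramC s t : gram s t = gram t s.
Proof.
by rewrite /gram exchange_big; apply: eq_bigr => g _; apply: eq_bigr => h _; rewrite coincidenceC.
Qed.

Lemma gram_translate k s t :
  gram [seq (k * g)%g | g <- s] [seq (k * g)%g | g <- t] = gram s t.
Proof.
rewrite /gram big_map; apply: eq_bigr => g _; rewrite big_map.
by apply: eq_bigr => h _; rewrite coincidenceM.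
Qed.

Lemma gram_cat s t : gram (s ++ t) (s ++ t) = gram s s + gram t t + 2 * gram s t.
Proof.
have E u : \sum_(g <- u) \sum_(h <- s ++ t) coincidence g h = gram u s + gram u t.
  by rewrite -big_split; apply: eq_bigr => g _; rewrite big_cat.
by rewrite {1}/gram big_cat /= !E (gramC t s); ring.
Qed.

Definition visits (x : X) (s : seq G) (k : G) : R := \sum_(g <- s) (label x g == label x k)%:R.

Lemma visits_count x s k :
  visits x s k = (count_mem (label x k) [seq label x g | g <- s])%:R.
Proof. by rewrite count_sum big_map. Qed.

(** The squared l2 distance between the multiplicity functions on the orbit of [x] defined by [s]
    and by its translate under [k^-1]. *)
Definition spread (s : seq G) (k : G) (x : X) : R :=
  gram_at x s s + gram_at x [seq (k^-1 * g)%g | g <- s] [seq (k^-1 * g)%g | g <- s]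
  - 2 * gram_at x [seq (k^-1 * g)%g | g <- s] s.

Lemma visits_diff x s k : (visits x s k - visits x s 1%g) ^+ 2 <= spread s k x.
Proof.
have -> : visits x s k = visits x [seq (k^-1 * g)%g | g <- s] 1%g.
  by rewrite /visits big_map; apply: eq_bigr => g _; rewrite -(labelM x k^-1%g g k) mulVg.
have := count_diff_sqr R [seq label x g | g <- [seq (k^-1 * g)%g | g <- s]]
  [seq label x g | g <- s] (label x 1%g).
rewrite -!visits_count => /le_trans; apply.
have E (u v : seq G) : \sum_(p <- [seq label x g | g <- u]) \sum_(q <- [seq label x g | g <- v])
    (p == q)%:R = gram_at x u v.
  by rewrite big_map; apply: eq_bigr => g _; rewrite big_map.
by rewrite !E /spread [X in X - _]addrC.
Qed.

(** The inequality [|v| <= e + v ^ 2 / e] makes the bound linear in [spread], so that it can be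
    integrated. *)
Lemma visits_close x s k (e : R) : 0 < e ->
  `|visits x s k - visits x s 1%g| <= e + spread s k x / e.
Proof.
move=> e0; have := visits_diff x s k; set D := spread s k x.
set v := (_ - _) => vD.
have e2 : 0 < e ^+ 2 by rewrite exprn_gt0.
have : `|v| * e <= e ^+ 2 + D.
  have : `|v| ^+ 2 <= D by rewrite real_normK ?num_real.
  have := normr_ge0 v; have := sqr_ge0 (`|v| - e); nra.
by rewrite -ler_pdivlMr // mulrDl expr2 mulfK // gt_eqF.
Qed.

(** * Families separating the points of an orbit *)

Definition separated (t : seq G) : set X := [set x | uniq [seq label x g | g <- t]].

Lemma measurable_separated t : measurable (separated t).
Proof.
elim: t => [|g t IH].
  by rewrite (_ : separated _ = setT) //; apply/seteqP; split.
have mN : measurable [set x | label x g \notin [seq label x h | h <- t]].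
  elim: t {IH} => [|h t IH].
    by rewrite (_ : [set x | _] = setT) //; apply/seteqP; split.
  rewrite (_ : [set x | _] = ~` coincide g h `&` [set x | label x g \notin [seq label x h | h <- t]]).
    by apply: measurableI => //; apply: measurableC; exact: measurable_coincide.
  apply/seteqP; split => x /=; rewrite inE negb_or.
    by move=> /andP[/negP].
  by move=> [/negP -> ->].
rewrite (_ : separated _ = [set x | label x g \notin [seq label x h | h <- t]] `&` separated t).
  exact: measurableI.
by apply/seteqP; split => x /=; [move=> /andP[]|move=> [p q]; apply/andP].
Qed.

Lemma visits_separated x s t : separated t x -> \sum_(k <- t) visits x s k <= (size s)%:R.
Proof.
move=> ut; rewrite -(size_map (label x)).
apply: le_trans (_ : (\sum_(y <- [seq label x k | k <- t]) count_mem y [seq label x g | g <- s])%:R <= _).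
  by rewrite natr_sum big_map; apply: ler_sum => k _; rewrite visits_count.
by rewrite ler_nat; exact: sum_count_uniq.
Qed.

Definition separated_by (L : seq (seq G)) : set X := [set x | exists2 t, t \in L & separated t x].

Lemma measurable_separated_by L : measurable (separated_by L).
Proof.
elim: L => [|t L IH].
  by rewrite (_ : separated_by _ = set0) //; apply/seteqP; split => x // -[].
rewrite (_ : separated_by _ = separated t `|` separated_by L).
  by apply: measurableU => //; exact: measurable_separated.
apply/seteqP; split => x /=.
  by move=> [u]; rewrite inE => /predU1P[-> ?|uL ux]; [left|right; exists u].
by move=> [tx|[u uL ux]]; [exists t; rewrite ?mem_head|exists u; rewrite // inE uL orbT].
Qed.

(** If [t] separates [x], the counts at its [K] elements total at most [size s] and are all close to
    the count at 1. Elsewhere the trivial bound [size s] is used. As [t] depends on [x], errors are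
    summed over all of [flatten L]. *)
Lemma visits_bound x s L (K : nat) (e : R) : (0 < K)%N -> 0 < e ->
  (forall t, t \in L -> size t = K) ->
  visits x s 1%g <= (size s)%:R * \1_(~` separated_by L) x + (size s)%:R / K%:R
     + \sum_(k <- flatten L) (e + spread s k x / e).
Proof.
move=> K0 e0 sizeL; have K0' : 0 < K%:R :> R by rewrite ltr0n.
have pos k : 0 <= e + spread s k x / e by apply: le_trans (visits_close x s k e0).
have [xL|xL] := pselect (separated_by L x); last first.
  rewrite indicE mem_set // mulr1 -addrA -[leLHS]addr0 lerD //; last first.
    by rewrite addr_ge0 ?divr_ge0 ?ler0n // sumr_ge0.
  rewrite visits_count -(size_map (label x) s) ler_nat; exact: count_size.
rewrite indicE memNset ?mulr0 ?add0r; last by move=> /(_ xL).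
have [t tL tx] := xL.
have sub (F : G -> R) : (forall k, 0 <= F k) -> \sum_(k <- t) F k <= \sum_(k <- flatten L) F k.
  move=> F0; elim: L tL {sizeL xL} => // u L IH; rewrite inE /= big_cat /= => /predU1P[<-|/IH H].
    by rewrite lerDl sumr_ge0.
  by apply: (le_trans H); rewrite lerDr sumr_ge0.
rewrite -(ler_pM2r K0') mulrDl divfK ?gt_eqF //.
apply: (@le_trans _ _ (\sum_(k <- t) (visits x s k + (e + spread s k x / e)))).
  have -> : visits x s 1%g * K%:R = \sum_(k <- t) visits x s 1%g.
    by rewrite big_const_seq count_predT iter_addr_0 (sizeL _ tL) mulr_natr.
  apply: ler_sum => k _; have := visits_close x s k e0.
  by rewrite ler_norml => /andP[+ _]; lra.
rewrite big_split /= lerD ?visits_separated //.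
apply: (le_trans (sub _ pos)); rewrite -[leLHS]mulr1 ler_wpM2l ?sumr_ge0 //.
by rewrite ler1n.
Qed.

Lemma gram_ge0 s t : 0 <= gram s t.
Proof. by apply: sumr_ge0 => g _; apply: sumr_ge0 => h _; exact: coincidence_ge0. Qed.

Lemma spread_mean s k : has_mean mu (spread s k)
  (2 * (gram s s - gram [seq (k^-1 * g)%g | g <- s] s)).
Proof.
have := has_meanD (has_meanD (gram_mean s s)
  (gram_mean [seq (k^-1 * g)%g | g <- s] [seq (k^-1 * g)%g | g <- s]))
  (has_meanZ (- 2) (gram_mean [seq (k^-1 * g)%g | g <- s] s)).
rewrite gram_translate (_ : _ + _ + _ * _ = 2 * (gram s s - gram [seq (k^-1 * g)%g | g <- s] s)).
  by congr has_mean; apply/funext=> x; rewrite /spread mulNr.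
by ring.
Qed.

(* A family [s] nearly minimizing [gram s s / (size s)^2] is nearly invariant under
   left translation, by the parallelogram law. *)
Lemma near_invariant_family (e : R) : 0 < e -> exists s : seq G, (0 < size s)%N /\
  forall k, gram s s - gram [seq (k^-1 * g)%g | g <- s] s <= 2 * e * (size s)%:R ^+ 2.
Proof.
move=> e0; pose S := [set gram s s / (size s)%:R ^+ 2 | s in [set s : seq G | (0 < size s)%N]].
have hS : has_inf S.
  split; first by exists (gram [:: 1%g] [:: 1%g] / 1%:R ^+ 2), [:: 1%g].
  by exists 0 => _ [s _ <-]; rewrite divr_ge0 ?gram_ge0 // exprn_ge0 // ler0n.
have [_ [s s0 <-] Hs] := inf_adherent e0 hS.
exists s; split => // k.
have N0 : 0 < (size s)%:R ^+ 2 :> R by rewrite exprn_gt0 // ltr0n.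
rewrite ltr_pdivrMr // in Hs.
pose t := [seq (k^-1 * g)%g | g <- s].
have : inf S <= gram (t ++ s) (t ++ s) / (size (t ++ s))%:R ^+ 2.
  apply: ge_inf; first exact: hS.2.
  by exists (t ++ s) => //=; rewrite size_cat ltn_addl.
rewrite size_cat size_map addnn -mul2n natrM exprMn ler_pdivlMr ?mulr_gt0 ?exprn_gt0 ?ltr0n //.
rewrite gram_cat gram_translate -/t.
by move: ((size s)%:R ^+ 2) N0 Hs => N N0; lra.
Qed.

Lemma visits_mean s k : has_mean mu (fun x => visits x s k) (\sum_(g <- s) coincidence g k).
Proof. by apply: has_mean_sum => g; exact: coincide_mean. Qed.

(** For a nearly invariant [s] of size [N], the mean visit counts [V k] exceed [V 1] by little, so
    [gram s s], their sum over [s], is at most about [N * V 1]. Integrating [visits_bound] bounds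
    [V 1], and division by [N ^ 2] leaves the claim. *)
Lemma separated_measure_bound (c : R) L (K : nat) : (0 < K)%N ->
  (forall t, t \in L -> size t = K) ->
  (forall s : seq G, c * (size s)%:R ^+ 2 <= gram s s) ->
  c <= fine (mu (~` separated_by L)) + K%:R^-1.
Proof.
move=> K0 sizeL Hc; apply/ler_addgt0Pr => e e0.
pose n := size (flatten L).
(* There are [n] errors from [flatten L] and one from replacing [V k] by [V 1], each at most
   [5 * (N * dl)]: in total [N * e]. The family is invariant within [dl ^ 2] because the mean spread
   gets divided by [N * dl]. *)
pose dl : R := e / (5 * n.+1%:R).
have n0 : 0 < n.+1%:R :> R by rewrite ltr0n.
have dl0 : 0 < dl by rewrite divr_gt0 // mulr_gt0.
have [s [s0 Hs]] := near_invariant_family (exprn_gt0 2 dl0).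
pose N : R := (size s)%:R; have N0 : 0 < N by rewrite ltr0n.
have Nd0 : 0 < N * dl by rewrite mulr_gt0.
pose D k := 2 * (gram s s - gram [seq (k^-1 * g)%g | g <- s] s).
have errm k : has_mean mu (fun x => N * dl + spread s k x / (N * dl)) (N * dl + (N * dl)^-1 * D k).
  have := has_meanD (has_mean_cst mu (N * dl)) (has_meanZ (N * dl)^-1 (spread_mean s k)).
  by congr has_mean; apply/funext=> x; rewrite [_^-1 * _]mulrC.
have err k : N * dl + (N * dl)^-1 * D k <= 5 * (N * dl).
  have : (N * dl)^-1 * D k <= 4 * (N * dl).
    rewrite mulrC ler_pdivrMr //; have := Hs k; rewrite /D -/N.
    by move: (gram _ _ - _) => q; rewrite (_ : 4 * (N * dl) * (N * dl) = 2 * (2 * dl ^+ 2 * N ^+ 2)); [lra|ring].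
  lra.
pose V k := \sum_(g <- s) coincidence g k.
have Vk k : V k <= V 1%g + 5 * (N * dl).
  have : V k <= V 1%g + (N * dl + (N * dl)^-1 * D k).
    apply: (has_mean_le (visits_mean s k) (has_meanD (visits_mean s 1%g) (errm k))) => x.
    by have := visits_close x s k Nd0; rewrite ler_norml => /andP[_]; lra.
  by have := err k; lra.
have V1 : V 1%g <= N * fine (mu (~` separated_by L)) + N / K%:R + n%:R * (5 * (N * dl)).
  have mW : measurable (~` separated_by L) by apply: measurableC; exact: measurable_separated_by.
  have : V 1%g <= N * fine (mu (~` separated_by L)) + N / K%:R +
      \sum_(k <- flatten L) (N * dl + (N * dl)^-1 * D k).
    apply: (has_mean_le (visits_mean s 1%g) (has_meanD (has_meanD
      (has_meanZ N (has_mean_indic mu mW)) (has_mean_cst mu (N / K%:R)))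
      (has_mean_sum (flatten L) errm))) => x.
    exact: visits_bound.
  move/le_trans; apply; rewrite lerD2l.
  apply: (@le_trans _ _ (\sum_(k <- flatten L) 5 * (N * dl))); first by apply: ler_sum => k _; exact: err.
  by rewrite big_const_seq count_predT iter_addr_0 -[leLHS]mulr_natl.
have gs : gram s s <= N * (V 1%g + 5 * (N * dl)).
  rewrite /gram exchange_big /=.
  apply: (@le_trans _ _ (\sum_(h <- s) (V 1%g + 5 * (N * dl)))); first by apply: ler_sum => h _; exact: Vk.
  by rewrite big_const_seq count_predT iter_addr_0 -[leLHS]mulr_natl.
have := le_trans (Hc s) gs; rewrite -/N expr2 mulrCA ler_pM2l // => cN.
rewrite -(ler_pM2l N0) mulrC.
have En : 5 * (N * dl) * n.+1%:R = N * e by rewrite /dl; field; rewrite gt_eqF.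
have nS : n.+1%:R = n%:R + 1 :> R by rewrite natr1.
rewrite nS mulrDr mulr1 in En.
move: cN V1 En; rewrite !mulrDr.
rewrite [n%:R * _]mulrC.
by move: (5 * (N * dl)) (5 * (N * dl) * n%:R) => p q; lra.
Qed.

Definition small_orbit (K : nat) : set X :=
  [set x | forall t : seq G, size t = K -> ~ separated t x].

Lemma small_orbit_min K x : small_orbit K x -> exists g, forall h, label x g <= label x h.
Proof.
move=> smallx; apply: contrapT => nomin.
have lower g : exists h, label x h < label x g.
  apply: contrapT => H; apply: nomin; exists g => h; rewrite leNgt; apply/negP => hg.
  by apply: H; exists h.
suff [t [tK st]] : exists t : seq G, size t = K.+1 /\ sorted <%R [seq label x g | g <- t].
  case: t tK st => // g t [tK] /path_sorted st; apply: (smallx t tK).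
  exact: lt_sorted_uniq.
elim: K {smallx} => [|K [t [tK st]]]; first by exists [:: 1%g].
case: t tK st => // g t tK st; have [h hg] := lower g.
by exists [:: h, g & t]; split; [rewrite /= -tK|rewrite /= hg].
Qed.

Variable enum : nat -> G.
Hypothesis enum_surj : forall g, exists n, enum n = g.

(** An enumeration of the finite lists; a number that decodes to nothing gives the empty list. *)
Let enum_seq n : seq G := [seq enum k | k <- odflt [::] (unpickle n)].

Let enum_seq_surj t : exists n, enum_seq n = t.
Proof.
have [r Hr] := choice enum_surj.
exists (pickle [seq r g | g <- t]); rewrite /enum_seq pickleK /= -map_comp.
by rewrite -[RHS]map_id; apply: eq_map => g /=.
Qed.

(** Finite stages exhausting the lists of length [K], so that the orbits with at least [K] points
    form an increasing union of sets covered by [separated_measure_bound]. *)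
Let chunk K n : seq (seq G) := [seq t <- [seq enum_seq k | k <- iota 0 n] | size t == K].

Let chunk_size K n t : t \in chunk K n -> size t = K.
Proof. by rewrite mem_filter => /andP[/eqP]. Qed.

Let small_orbitC K : ~` small_orbit K = \bigcup_n separated_by (chunk K n).
Proof.
apply/seteqP; split => x /=.
  move=> /existsNP[t /not_implyP[tK /contrapT tx]].
  have [n nt] := enum_seq_surj t; exists n.+1 => //; exists t => //.
  by rewrite mem_filter tK eqxx andTb; apply/mapP; exists n; [rewrite mem_iota add0n ltnSn|rewrite nt].
by move=> [n _ [t tn tx]] /(_ t (chunk_size tn)).
Qed.

Lemma measurable_small_orbit K : measurable (small_orbit K).
Proof.
rewrite -[small_orbit K]setCK small_orbitC; apply: measurableC.
by apply: bigcupT_measurable => n; exact: measurable_separated_by.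
Qed.

Hypothesis erg : ergodic mu a.

Lemma small_orbit_invariant K g : a g @^-1` small_orbit K = small_orbit K.
Proof.
have lab x h : label (a g x) h = label x (h * g)%g by rewrite /label aM.
apply/seteqP; split => x /= H t tK tx.
  apply: (H [seq (h * g^-1)%g | h <- t]); first by rewrite size_map.
  rewrite /separated /= -map_comp; move: tx; rewrite /separated /=.
  by congr (uniq _ = true); apply: eq_map => h /=; rewrite lab mulgVK.
apply: (H [seq (h * g)%g | h <- t]); first by rewrite size_map.
rewrite /separated /= -map_comp; move: tx; rewrite /separated /=.
by congr (uniq _ = true); apply: eq_map => h /=; rewrite lab.
Qed.

(** Take [K] with [K^-1 <= c / 2]. If the invariant set of small orbits were null, the sets
    separated by the chunks would increase to full measure, but each has measure at most
    [1 - c / 2]. *)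
Lemma gram_small_orbit (c : R) : 0 < c ->
  (forall s : seq G, c * (size s)%:R ^+ 2 <= gram s s) ->
  exists K, mu (small_orbit K) = 1%E.
Proof.
move=> c0 Hc; have [n0 _ Hn0] := nbhs_infty_ger (2 / c).
pose K := n0.+1; exists K.
have Kc : K%:R^-1 <= c / 2.
  rewrite -[leRHS]invrK invf_div lef_pV2 ?posrE ?ltr0n ?divr_gt0 //.
  by apply: Hn0 => /=.
have [mu0|//] := erg (measurable_small_orbit K) (small_orbit_invariant K).
exfalso; pose F n := separated_by (chunk K n).
have mF n : measurable (F n) by exact: measurable_separated_by.
have cF : mu \o F @ \oo --> mu (\bigcup_n F n).
  apply: nondecreasing_cvg_mu => //; first exact: bigcupT_measurable.
  move=> m n mn; apply/subsetPset => x [t tm tx]; exists t => //.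
  move: tm; rewrite !mem_filter => /andP[-> /=] /mapP[k]; rewrite mem_iota add0n => km ->.
  by rewrite map_f // mem_iota add0n (leq_trans km).
have mU : mu (\bigcup_n F n) = 1%E.
  by rewrite -small_orbitC probability_setC ?mu0 ?sube0 //; exact: measurable_small_orbit.
have : (1 <= (1 - c / 2)%:E :> \bar R)%E.
  rewrite -mU -(cvg_lim _ cF) //; apply: lime_le; first by apply/cvg_ex; exists (mu (\bigcup_n F n)).
  apply: nearW => n /=.
  have := separated_measure_bound (ltn0Sn n0) (@chunk_size K n) Hc.
  rewrite -/(F n) probability_setC // -[mu (F n)]fineK ?fin_num_measure //.
  by rewrite -EFinB /= lee_fin -/K; move: (K%:R^-1) Kc (fine _) => q Kq r; lra.
by rewrite lee_fin; lra.
Qed.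

(** Ergodicity makes the minimal label of the orbit almost everywhere a constant [c]; as it is
    attained and [f] is injective, almost every orbit contains the one point of label [c]. *)
Lemma small_orbit_transitive K : mu (small_orbit K) = 1%E -> essentially_transitive mu a.
Proof.
move=> muK; pose A q : set X := [set x | exists g, label x g < q].
have mA q : measurable (A q).
  rewrite (_ : A q = \bigcup_n [set x | label x (enum n) < q]).
    apply: bigcupT_measurable => n.
    rewrite (_ : [set x | _] = (label^~ (enum n)) @^-1` `]-oo, q[).
      by rewrite -[_ @^-1` _]setTI; apply: label_measurable.
    by apply/seteqP; split => x /=; rewrite in_itv.
  apply/seteqP; split => x /= [g]; last by move=> _ gq; exists (enum g).
  by have [n <-] := enum_surj g; exists n.
have A01 q : mu (A q) = 0%E \/ mu (A q) = 1%E.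
  apply: erg => // g; apply/seteqP; split => x /= -[h hq].
    by exists (h * g)%g; rewrite /label aM.
  by exists (h * g^-1)%g; rewrite /label -aM mulgVK.
pose S := [set q | mu (A q) = 0%E].
have nullA q : S q -> mu.-negligible (A q) by move=> ?; apply/negligibleP.
have nullC (B : set X) : measurable B -> mu B = 1%E -> mu.-negligible (~` B).
  move=> mB B1; apply/negligibleP; first exact: measurableC.
  by have := probability_setC mu mB; rewrite B1 subee.
have nullK := nullC _ (measurable_small_orbit K) muK.
have pick Z : mu.-negligible Z -> exists x, ~ Z x.
  move=> nZ; apply: contrapT => H; have ZT : Z = setT.
    by apply/seteqP; split => // x _; apply: contrapT => nZx; apply: H; exists x.
  move: nZ; rewrite ZT => /(negligibleP _ measurableT) T0.
  by have := probability_setT mu; rewrite T0 => /eqP; rewrite eq_sym onee_eq0.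
have Sdown p q : p <= q -> S q -> S p.
  move=> pq Sq; apply/eqP; rewrite eq_le measure_ge0 andbT -Sq.
  apply: le_measure; rewrite ?inE // => x [g gp]; exists g; exact: lt_le_trans pq.
have minx x : ~ (~` small_orbit K) x -> exists g, forall h, label x g <= label x h.
  by move=> /contrapT/small_orbit_min.
have hS : has_sup S.
  split.
    (* If all [A (- n)] had full measure, almost every orbit would have labels unbounded below,
       against the existence of a minimum. *)
    apply: contrapT => nS.
    have [x /not_orP[/minx[g Hg] nx]] : exists x, ~ (~` small_orbit K `|` \bigcup_n ~` A (- n%:R)) x.
      apply: pick; apply: negligibleU => //; apply: negligible_bigcup => n.
      by apply: nullC => //; have [An|//] := A01 (- n%:R); case: nS; exists (- n%:R).
    have [n _ Hn] := nbhs_infty_ger (- label x g).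
    apply: nx; exists n => // -[h]; rewrite ltNge => /negP; apply.
    by apply: le_trans (Hg h); rewrite lerNl; exact: (Hn n (leqnn n)).
  apply: contrapT => nub.
  have [x nx] : exists x, ~ (\bigcup_n A n%:R) x.
    apply: pick; apply: negligible_bigcup => n; apply: nullA; apply: contrapT => nSn.
    apply: nub; exists n%:R => p Sp; rewrite leNgt; apply/negP => np.
    by apply: nSn; exact: Sdown (ltW np) Sp.
  have [n _ Hn] := nbhs_infty_gtr (label x 1%g).
  by apply: nx; exists n => //; exists 1%g; exact: (Hn n (leqnn n)).
(* [A q] is null below [c] and conull above it; [Z] collects countably many exceptional sets
   approaching [c] from both sides. *)
pose c := sup S; pose eps n : R := n.+1%:R^-1.
have eps0 n : 0 < eps n by rewrite invr_gt0 ltr0n.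
pose Z := ~` small_orbit K `|` (\bigcup_n A (c - eps n) `|` \bigcup_n ~` A (c + eps n)).
have nullZ : mu.-negligible Z.
  apply: negligibleU => //; apply: negligibleU; apply: negligible_bigcup => n.
    apply: nullA; have [p Sp cp] := sup_adherent (eps0 n) hS.
    exact: Sdown (ltW cp) Sp.
  apply: nullC => //; have [Sn|//] := A01 (c + eps n).
  have : c + eps n <= c by apply: sup_upper_bound.
  by rewrite gerDl leNgt eps0.
have orbitc x : ~ Z x -> exists g, label x g = c.
  move=> /not_orP[/minx[g Hg] /not_orP[nA1 nA2]]; exists g.
  have small (e : R) : 0 < e -> exists n, eps n <= e.
    move=> e0; have [n _ Hn] := nbhs_infty_ger e^-1; exists n.
    by rewrite /eps -[leRHS]invrK lef_pV2 ?posrE ?invr_gt0 ?ltr0n //; apply: Hn => /=.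
  apply/eqP; rewrite eq_le; apply/andP; split; rewrite leNgt; apply/negP => lt.
    have [n Hn] := small (label x g - c) (ltac:(by rewrite subr_gt0)).
    apply: nA2; exists n => // -[h]; rewrite ltNge => /negP; apply.
    by apply: le_trans (Hg h); lra.
  have [n Hn] := small ((c - label x g) / 2) (ltac:(by rewrite divr_gt0 // subr_gt0)).
  by apply: nA1; exists n => //; exists g; move: Hn lt; move: (eps n) => q; lra.
have [x0 /orbitc[g0 x0c]] := pick Z nullZ.
exists (a g0 x0); pose O : set X := range (fun g => a g (a g0 x0)); change (mu O = 1%E).
have mO : measurable O.
  rewrite (_ : O = \bigcup_n [set a (enum n) (a g0 x0)]).
    apply: bigcupT_measurable => n.
    rewrite (_ : [set _] = f @^-1` [set f (a (enum n) (a g0 x0))]).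
      by rewrite -[_ @^-1` _]setTI; apply: fmeas.
    by apply/seteqP; split => x /=; [move=> ->|move=> /finj].
  apply/seteqP; split => x /=.
    by move=> [g _ <-]; have [n <-] := enum_surj g; exists n.
  by move=> [n _ ->]; exists (enum n).
have nO : mu.-negligible (~` O).
  apply: negligibleS nullZ => x nOx; apply: contrapT => /orbitc[g gc].
  apply: nOx; exists g^-1%g => //.
  have : a g x = a g0 x0 by apply: finj; rewrite -/(label x g) gc -x0c.
  by move=> <-; rewrite -aM mulVg a1.
have O0 : mu (~` O) = 0%E by apply/negligibleP => //; exact: measurableC.
by have := probability_setC mu (measurableC mO); rewrite O0 setCK sube0.
Qed.

End Action.

(** * Enumerations and the dichotomy for ergodic actions *)

Lemma countable_group_enum (G : groupType) : countable_group G ->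
  exists enum : nat -> G, forall g, exists n, enum n = g.
Proof.
move=> [enc encI].
have /choice[enum Henum] n : exists g : G, (exists h, enc h = n) -> enc g = n.
  by have [[g gn]|no] := pselect (exists h, enc h = n); [exists g|exists 1%g].
by exists enum => g; exists (enc g); apply: encI; apply: Henum; exists g.
Qed.

Lemma pair_bool_enum (T : Type) (enum : nat -> T) : (forall g, exists n, enum n = g) ->
  forall p : T * bool, exists n, (enum n./2, odd n) = p.
Proof.
move=> surj [g b]; have [n <-] := surj g.
by exists (b + n.*2)%N; rewrite half_bit_double oddD odd_double addbF oddb.
Qed.

Lemma rep_equiv_trace (R : realType) (G : groupType) n m (pi : G -> 'M[R[i]]_n)
    (rho : G -> 'M[R[i]]_m) g : rep_equiv pi rho -> \tr (pi g) = \tr (rho g).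
Proof.
move=> [_ [U [UU1 UU2 HU]]].
by rewrite -[pi g]mulmx1 -UU1 mulmxA -HU mxtrace_mulC mulmxA UU2 mul1mx.
Qed.

Theorem theorem8 (R : realType) (G : groupType) :
  countable_group G -> character_rigid R G -> countably_many_fd_reps R G ->
  forall (d : measure_display) (X : measurableType d) (mu : probability X R)
         (a : G -> X -> X),
    standard_borel R X -> pmp_action mu a -> ergodic mu a ->
    essentially_transitive mu a \/
    (forall g : G, ~ @group_center G g -> mu (Fix a g) = 0%E).
Proof.
move=> cG rigid [dim [rho [rhoU rhoAll]]] d X mu a [f [finj fmeas _ _]] pmp erg.
have [enum enum_surj] := countable_group_enum cG.
have [[g0 [g0Z g0fix]]|none] :=
  pselect (exists g, ~ @group_center G g /\ mu (Fix a g) <> 0%E); last first.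
  by right=> g gZ; apply: contrapT => gfix; apply: none; exists g.
left; pose phi g := real_complex R (fix_measure mu a g).
(* All listed representations are taken, including reducible ones and those of dimension 0;
   [extreme_atom] returns a [chi k] that is known to be a trace. *)
pose chi k := real_of (fun g => \tr (rho k g) / (dim k)%:R).
have phi_trace : is_trace phi := fix_measure_trace finj fmeas pmp.
have phi_traces : traces (real_of phi) by rewrite /traces /= real_ofK.
have phi_g0 : real_of phi (g0, true) != 0.
  apply/eqP => fix0; apply: g0fix.
  have fin0 : mu (Fix a g0) \is a fin_num.
    by apply: fin_num_measure; exact: (measurable_Fix finj fmeas pmp).
  by rewrite -(fineK fin0); congr EFin; exact: fix0.
have ext x : extreme_point (@traces R G) x -> x (g0, true) = 0 \/ exists k, x = chi k.
  move=> /extreme_trace_character /rigid[[n [pi [piU _ piE]]]|/(_ g0 g0Z) vanish].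
    right; have [k pik] := rhoAll n pi piU; exists k.
    rewrite -[x]cplx_ofK; congr real_of; apply/funext=> g.
    by rewrite piE (rep_equiv_trace g pik) (proj1 pik).
  by left; exact: (congr1 (@complex.Re R) vanish).
have [k [al [y [/andP[al0 al1] chi_tr y_tr phiE]]]] :=
  extreme_atom (pair_bool_enum enum_surj) (@traces_convex R G) (@traces_bound R G)
    (@traces_limit R G) phi_traces phi_g0 ext.
have chi_trace : is_trace (fun g => \tr (rho k g) / (dim k)%:R).
  by move: chi_tr; rewrite /traces /chi /= real_ofK.
(* In dimension 0 the quotient would be 0 at the identity, since [0^-1] is 0, whereas a trace is 1
   there. *)
have dim0 : (0 < dim k)%N.
  rewrite lt0n; apply/negP => /eqP dk; have [_ _ /eqP] := chi_trace.
  have -> : ((dim k)%:R : R[i]) = 0 by rewrite dk.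
  by rewrite invr0 mulr0 eq_sym oner_eq0.
have phi_split h : phi h =
    real_complex R al * (\tr (rho k h) / (dim k)%:R) + real_complex R (1 - al) * cplx_of y h.
  have := cplx_of_mix (chi k) y al h; rewrite /chi real_ofK => <-.
  by rewrite -[phi]real_ofK; congr Complex; exact: phiE.
have [y_pd _ _] := y_tr.
have low N (g : 'I_N -> G) := dominated_lower_bound g (rhoU k) dim0 (fun=> erefl)
  chi_trace y_pd (ltW al0) (ltW al1) (fun h => fine_ge0 (measure_ge0 mu (Fix a h))) phi_split.
have gram_low := gram_coincidence finj pmp low.
have c0 : 0 < al / (dim k)%:R ^+ 2 by rewrite divr_gt0 // exprn_gt0 // ltr0n.
have [K muK] := gram_small_orbit finj fmeas pmp enum_surj erg c0 gram_low.
exact: small_orbit_transitive muK.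
Qed.
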